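(* The preorder $\{\langle e,i\rangle : W_e\le_{\mathrm{wtt}}W_i\}$ of weak truth-table reducibility among r.e. sets is $\Sigma^0_3$-complete.
   Context: $W_e$ is the $e$-th r.e. set; $\le_{\mathrm{wtt}}$ is weak truth-table reducibility (Turing reducibility with a computable bound on the use). A preorder $P$ is $\Sigma^0_3$-complete if it is $\Sigma^0_3$ and for every $\Sigma^0_3$ preorder $Q$ on $\omega$ there is a computable $f$ with $\langle x,y\rangle\in Q\iff\langle f(x),f(y)\rangle\in P$. *)

(* Defs.v *)
From Stdlib Require Import Arith Lia Relation_Definitions.
From Stdlib Require Cantor.

Notation "⟨ x , y ⟩" := (Cantor.to_nat (x, y)) (at level 0, x, y at level 99).

(** Oracle programs compute partial functions on [nat]; functions of several
    arguments are represented through the Cantor pairing bijection. *)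
Inductive prog : Type :=
| Zero | Succ | Fst | Snd
| Query
| Pair (f g : prog)
| Comp (f g : prog)
| Prec (f g : prog)
| Mu (f : prog).

(** [eval O p x y u]: with oracle [O], program [p] halts on input [x] with
    output [y], and [u] is the use of this computation, that is, one plus the
    largest number queried, or [0] if there is no query.
    [Prec] is primitive recursion on the second component of the input.
    On [⟨a, m⟩], [Mu f] searches for the least [n >= m] with [f ⟨a, n⟩ = 0],
    and diverges if some earlier value of [f] is undefined; unbounded
    minimization proper is the case [m = 0]. *)
Inductive eval (O : nat -> Prop) : prog -> nat -> nat -> nat -> Prop :=
| eval_zero x : eval O Zero x 0 0
| eval_succ x : eval O Succ x (S x) 0
| eval_fst a b : eval O Fst ⟨a, b⟩ a 0
| eval_snd a b : eval O Snd ⟨a, b⟩ b 0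
| eval_query_in x : O x -> eval O Query x 1 (S x)
| eval_query_out x : ~ O x -> eval O Query x 0 (S x)
| eval_pair f g x a b u v :
    eval O f x a u -> eval O g x b v ->
    eval O (Pair f g) x ⟨a, b⟩ (Nat.max u v)
| eval_comp f g x y z u v :
    eval O g x y u -> eval O f y z v ->
    eval O (Comp f g) x z (Nat.max u v)
| eval_prec_0 f g a y u :
    eval O f a y u -> eval O (Prec f g) ⟨a, 0⟩ y u
| eval_prec_S f g a n y z u v :
    eval O (Prec f g) ⟨a, n⟩ y u -> eval O g ⟨a, ⟨n, y⟩⟩ z v ->
    eval O (Prec f g) ⟨a, S n⟩ z (Nat.max u v)
| eval_mu_stop f a m u :
    eval O f ⟨a, m⟩ 0 u -> eval O (Mu f) ⟨a, m⟩ m u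
| eval_mu_next f a m k n u v :
    eval O f ⟨a, m⟩ (S k) u -> eval O (Mu f) ⟨a, S m⟩ n v ->
    eval O (Mu f) ⟨a, m⟩ n (Nat.max u v).

(** Gödel numbering; it is a bijection, see [code_inj] and [code_surj]. *)
Fixpoint code (p : prog) : nat :=
  match p with
  | Zero => 0
  | Succ => 1
  | Fst => 2
  | Snd => 3
  | Query => 4
  | Pair f g => 5 + 4 * ⟨code f, code g⟩
  | Comp f g => 6 + 4 * ⟨code f, code g⟩
  | Prec f g => 7 + 4 * ⟨code f, code g⟩
  | Mu f => 8 + 4 * code f
  end.

Definition no_oracle : nat -> Prop := fun _ => False.

Definition W (e : nat) : nat -> Prop :=
  fun x => exists p y u, code p = e /\ eval no_oracle p x y u.

Definition computable (f : nat -> nat) : Prop :=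
  exists p, forall x, exists u, eval no_oracle p x (f x) u.

(** [y] is the value at [x] of the characteristic function of [A]. *)
Definition char_val (A : nat -> Prop) (x y : nat) : Prop :=
  (A x /\ y = 1) \/ (~ A x /\ y = 0).

Definition computable_set (A : nat -> Prop) : Prop :=
  exists f, computable f /\ forall x, char_val A x (f x).

Definition wtt_le (A B : nat -> Prop) : Prop :=
  exists (p : prog) (h : nat -> nat), computable h /\
    forall x, exists y u, eval B p x y u /\ char_val A x y /\ u <= h x.

Definition sigma3_set (A : nat -> Prop) : Prop :=
  exists R, computable_set R /\
    forall x, A x <-> exists a, forall b, exists c, R ⟨x, ⟨a, ⟨b, c⟩⟩⟩.

Definition pair_set (P : relation nat) : nat -> Prop :=
  fun n => exists x y, n = ⟨x, y⟩ /\ P x y.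

Definition sigma3_preorder (P : relation nat) : Prop :=
  preorder nat P /\ sigma3_set (pair_set P).

Definition sigma3_complete_preorder (P : relation nat) : Prop :=
  sigma3_preorder P /\
  forall Q : relation nat, sigma3_preorder Q ->
    exists f, computable f /\ forall x y, Q x y <-> P (f x) (f y).

Lemma code_inj p q : code p = code q -> p = q.
Proof.
revert q; induction p; intros [] H; cbn [code] in H; try lia; try reflexivity.
1-3: match type of H with _ + 4 * ⟨?a, ?b⟩ = _ + 4 * ⟨?c, ?d⟩ =>
       assert (E : (a, b) = (c, d)) by (apply Cantor.to_nat_inj; lia) end;
     injection E as E1 E2; f_equal; auto.
f_equal; apply IHp; lia.
Qed.

Lemma code_surj n : exists p, code p = n.
Proof.
induction n as [n IH] using lt_wf_ind.
destruct (le_lt_dec 5 n) as [Hn|Hn].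
- set (k := (n - 5) / 4); set (r := (n - 5) mod 4).
  assert (E : n - 5 = 4 * k + r) by (apply Nat.div_mod; lia).
  assert (Hr : r < 4) by (apply Nat.mod_upper_bound; lia).
  clearbody k r.
  destruct (IH k) as [s Hs]; [lia|].
  destruct (Cantor.of_nat k) as [i j] eqn:Ek.
  assert (Hk : ⟨i, j⟩ = k) by (rewrite <- Ek; apply Cantor.cancel_to_of).
  pose proof (Cantor.to_nat_non_decreasing i j).
  destruct (IH i) as [f Hf]; [lia|]; destruct (IH j) as [g Hg]; [lia|].
  destruct r as [|[|[|[|]]]]; [| | | |lia];
  [exists (Pair f g) | exists (Comp f g) | exists (Prec f g) | exists (Mu s)];
  cbn [code]; rewrite ?Hf, ?Hg, ?Hk, ?Hs; lia.
- destruct n as [|[|[|[|[|]]]]]; [| | | | |lia];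
  [exists Zero | exists Succ | exists Fst | exists Snd | exists Query];
  reflexivity.
Qed.

(* Main.v *)
From Stdlib Require Import Arith Lia List Bool Relation_Definitions Classical
  ClassicalEpsilon.
From Stdlib Require Cantor.
Require Import Defs.
Import ListNotations.

Opaque Cantor.to_nat Cantor.of_nat.

(** Upper bound: if the use is bounded by a computable [h], then [p] computes
    [W_e] from [W_i] iff for every [x] the stagewise computations agree with
    [W_e] at infinitely many stages, which is Pi_2.

    Hardness: write [Q x y] as "for some [a], the index [⟨⟨x, y⟩, a⟩] is confirmed
    infinitely often". Nodes of a binary tree guess which indices below their
    length are infinite, and each node runs one Friedberg-Muchnik requirement: to
    make the [x]-th set not computable from the [y]-th one by a given program. Its
    witnesses enter the [z]-th set simultaneously for all [z] reachable from [x]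
    along the guessed pairs, and nothing is done if [y] is reachable. Along the
    true path every node acts finitely often, so [~ Q x y] is diagonalized against
    all programs. If [Q x y], let [s] be the node on the true path that has just
    guessed a witness of this. Nodes extending [s] put a witness into the [y]-th
    set whenever they put it into the [x]-th one; nodes to the right of [s] are
    cancelled at every visit of [s]; all other nodes act finitely often
    altogether. Hence the [x]-th set is weak truth-table reducible to the [y]-th
    one. *)

(** The witness [a] of a Sigma_3 fact cannot be found effectively, so every candidate [a] receives
    its own index, and nodes guess the Pi_2 question whether that index is infinite. Guesses are
    closed under reachability because a number put into one set has to follow every guessed edge
    that leaves it. As [Q] is a preorder, true guesses lead from [x] only to sets [z] with [Q x z];
    hence, if [Q x y] fails, a true node can diagonalize without putting its witness into the oracle
    of its own computation. The tree is not traversed along a path: each stage belongs to a single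
    node, whose visits depend on its positive guesses alone. Negative guesses are never tested;
    priority makes up for this. The bound on the use is an obstacle for the upper bound only. In the
    hardness proof, the positive case gives a reduction whose only query at [w] is [w] itself, and
    the negative case defeats every Turing reduction, whatever its use. *)

(** * Pairing and evaluation *)

Notation pi1 n := (fst (Cantor.of_nat n)).
Notation pi2 n := (snd (Cantor.of_nat n)).

Lemma pi1_pair a b : pi1 ⟨a, b⟩ = a.
Proof. now rewrite Cantor.cancel_of_to. Qed.

Lemma pi2_pair a b : pi2 ⟨a, b⟩ = b.
Proof. now rewrite Cantor.cancel_of_to. Qed.

Lemma pair_pi n : ⟨pi1 n, pi2 n⟩ = n.
Proof. rewrite <- surjective_pairing; apply Cantor.cancel_to_of. Qed.

Lemma pair_inj a b c d : ⟨a, b⟩ = ⟨c, d⟩ -> a = c /\ b = d.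
Proof. intros H; apply Cantor.to_nat_inj in H; now injection H. Qed.

Lemma pair_ge a b : a <= ⟨a, b⟩ /\ b <= ⟨a, b⟩.
Proof. pose proof (Cantor.to_nat_non_decreasing a b); lia. Qed.

(** Several constructors of [eval] have a pair as input, on which plain inversion leaves equations
    between Cantor codes; reading the input through [pi1] and [pi2] avoids them. *)
Lemma eval_inv O p x y u :
  eval O p x y u ->
  match p with
  | Zero => y = 0 /\ u = 0
  | Succ => y = S x /\ u = 0
  | Fst => y = pi1 x /\ u = 0
  | Snd => y = pi2 x /\ u = 0
  | Query => char_val O x y /\ u = S x
  | Pair f g => exists a b v w,
      eval O f x a v /\ eval O g x b w /\ y = ⟨a, b⟩ /\ u = Nat.max v w
  | Comp f g => exists z v w,
      eval O g x z v /\ eval O f z y w /\ u = Nat.max v w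
  | Prec f g =>
      pi2 x = 0 /\ eval O f (pi1 x) y u \/
      exists n z v w, pi2 x = S n /\ eval O (Prec f g) ⟨pi1 x, n⟩ z v /\
        eval O g ⟨pi1 x, ⟨n, z⟩⟩ y w /\ u = Nat.max v w
  | Mu f =>
      eval O f x 0 u /\ y = pi2 x \/
      exists k v w, eval O f x (S k) v /\
        eval O (Mu f) ⟨pi1 x, S (pi2 x)⟩ y w /\ u = Nat.max v w
  end.
Proof.
unfold char_val; destruct 1; rewrite ?pi1_pair, ?pi2_pair; eauto 12.
Qed.

Lemma eval_det O p x y u :
  eval O p x y u -> forall y' u', eval O p x y' u' -> y = y' /\ u = u'.
Proof.
induction 1; intros y' u' E; apply eval_inv in E;
  rewrite ?pi1_pair, ?pi2_pair in E; unfold char_val in E;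
  repeat match goal with
  | H : exists _, _ |- _ => destruct H
  | H : _ /\ _ |- _ => destruct H
  | H : _ \/ _ |- _ => destruct H
  | H : S _ = S _ |- _ => injection H as ->
  | IH : forall y u, eval ?O ?p ?x y u -> _, H : eval ?O ?p ?x _ _ |- _ =>
      apply IH in H as []; subst
  end; subst; auto; try discriminate; contradiction.
Qed.

(** * Recursive functions *)

(** The program must not depend on the oracle, so that it can be used inside
    reductions. *)
Definition nat_recursive (f : nat -> nat) : Prop :=
  exists p, forall O x, eval O p x (f x) 0.

Lemma nat_recursive_ext f g :
  (forall x, f x = g x) -> nat_recursive f -> nat_recursive g.
Proof. intros E [p Hp]; exists p; intros; rewrite <- E; apply Hp. Qed.

Lemma nat_recursive_fst : nat_recursive (fun x => pi1 x).
Proof.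
exists Fst; intros O x; rewrite <- (pair_pi x) at 1; constructor.
Qed.

Lemma nat_recursive_snd : nat_recursive (fun x => pi2 x).
Proof.
exists Snd; intros O x; rewrite <- (pair_pi x) at 1; constructor.
Qed.

Lemma nat_recursive_succ : nat_recursive S.
Proof. exists Succ; intros; constructor. Qed.

Lemma nat_recursive_pair f g :
  nat_recursive f -> nat_recursive g -> nat_recursive (fun x => ⟨f x, g x⟩).
Proof.
intros [p Hp] [q Hq]; exists (Pair p q); intros O x.
apply (eval_pair O p q x _ _ 0 0); auto.
Qed.

Lemma nat_recursive_comp f g :
  nat_recursive f -> nat_recursive g -> nat_recursive (fun x => f (g x)).
Proof.
intros [p Hp] [q Hq]; exists (Comp p q); intros O x.
apply (eval_comp O p q x (g x) _ 0 0); auto.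
Qed.

Definition id_prog : prog := Pair Fst Snd.

Lemma eval_id O x : eval O id_prog x x 0.
Proof.
rewrite <- (pair_pi x); apply (eval_pair O Fst Snd _ _ _ 0 0); constructor.
Qed.

Lemma nat_recursive_id : nat_recursive (fun x => x).
Proof. exists id_prog; intros; apply eval_id. Qed.

Fixpoint const_prog (n : nat) : prog :=
  match n with 0 => Zero | S n => Comp Succ (const_prog n) end.

Lemma eval_const O n x : eval O (const_prog n) x n 0.
Proof.
induction n as [|n IH]; cbn; [constructor|].
apply (eval_comp O Succ (const_prog n) x n _ 0 0); [assumption|constructor].
Qed.

Lemma nat_recursive_const n : nat_recursive (fun _ => n).
Proof. exists (const_prog n); intros; apply eval_const. Qed.

Lemma nat_recursive_prec f g :
  nat_recursive f -> nat_recursive g ->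
  nat_recursive (fun x => nat_rect (fun _ => nat) (f (pi1 x))
                   (fun n y => g ⟨pi1 x, ⟨n, y⟩⟩) (pi2 x)).
Proof.
intros [p Hp] [q Hq]; exists (Prec p q); intros O x.
rewrite <- (pair_pi x) at 1.
generalize (pi1 x) as a; generalize (pi2 x) as n; intros n a.
induction n as [|n IH]; cbn; [constructor; auto|].
exact (eval_prec_S O p q a n _ _ 0 0 IH (Hq _ _)).
Qed.

Lemma nat_recursive_case f g :
  nat_recursive f -> nat_recursive g ->
  nat_recursive (fun x => match pi2 x with
                          | 0 => f (pi1 x)
                          | S n => g ⟨pi1 x, n⟩
                          end).
Proof.
intros Hf Hg.
assert (Hg' : nat_recursive (fun z => g ⟨pi1 z, pi1 (pi2 z)⟩)).
{ apply (nat_recursive_comp g); auto.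
  apply nat_recursive_pair; [apply nat_recursive_fst|].
  apply (nat_recursive_comp (fun x => pi1 x));
    [apply nat_recursive_fst|apply nat_recursive_snd]. }
eapply nat_recursive_ext; [|apply (nat_recursive_prec f _ Hf Hg')].
intros x; cbn beta.
destruct (pi2 x); cbn; [reflexivity|].
now rewrite pi1_pair, pi2_pair, pi1_pair.
Qed.

(** * Computable functions on coded data *)

Class Enc (A : Type) := enc : A -> nat.
#[export] Instance enc_nat : Enc nat := fun n => n.
#[export] Instance enc_bool : Enc bool := Nat.b2n.
#[export] Instance enc_prod A B `{Enc A} `{Enc B} : Enc (A * B) :=
  fun z => ⟨enc (fst z), enc (snd z)⟩.
#[export] Instance enc_option A `{Enc A} : Enc (option A) :=
  fun o => match o with None => 0 | Some a => S (enc a) end.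
#[export] Instance enc_list A `{Enc A} : Enc (list A) :=
  fix e (l : list A) : nat :=
    match l with nil => 0 | a :: l => S ⟨enc a, e l⟩ end.

(** A tracking function on codes is asked for, with arbitrary values elsewhere. The empty list and
    [None] have code 0 and all other lists and options a successor, so that case distinctions become
    tests for zero. *)
Definition recursive {A B} `{Enc A} `{Enc B} (f : A -> B) : Prop :=
  exists g, nat_recursive g /\ forall a, g (enc a) = enc (f a).

Section Closure.
Context {A B C : Type} `{EA : Enc A} `{EB : Enc B} `{EC : Enc C}.

Lemma rec_ext (f g : A -> B) :
  (forall a, f a = g a) -> recursive f -> recursive g.
Proof. intros E [h [Hh Eh]]; exists h; split; auto; intros; now rewrite <- E. Qed.

Lemma rec_comp (f : B -> C) (g : A -> B) :
  recursive f -> recursive g -> recursive (fun a => f (g a)).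
Proof.
intros [f' [Hf Ef]] [g' [Hg Eg]]; exists (fun x => f' (g' x)); split.
- now apply nat_recursive_comp.
- intros a; now rewrite Eg, Ef.
Qed.

Lemma rec_pair (f : A -> B) (g : A -> C) :
  recursive f -> recursive g -> recursive (fun a => (f a, g a)).
Proof.
intros [f' [Hf Ef]] [g' [Hg Eg]]; exists (fun x => ⟨f' x, g' x⟩); split.
- now apply nat_recursive_pair.
- intros a; now rewrite Eg, Ef.
Qed.

Lemma rec_fst (f : A -> B * C) : recursive f -> recursive (fun a => fst (f a)).
Proof.
intros [g [Hg Eg]]; exists (fun x => pi1 (g x)); split.
- apply (nat_recursive_comp (fun x => pi1 x)); auto using nat_recursive_fst.
- intros a; rewrite Eg; apply pi1_pair.
Qed.

Lemma rec_snd (f : A -> B * C) : recursive f -> recursive (fun a => snd (f a)).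
Proof.
intros [g [Hg Eg]]; exists (fun x => pi2 (g x)); split.
- apply (nat_recursive_comp (fun x => pi2 x)); auto using nat_recursive_snd.
- intros a; rewrite Eg; apply pi2_pair.
Qed.

Lemma rec_id : recursive (fun a : A => a).
Proof. exists (fun x => x); auto using nat_recursive_id. Qed.

Lemma rec_const (b : B) : recursive (fun _ : A => b).
Proof. exists (fun _ => enc b); auto using nat_recursive_const. Qed.

Lemma rec_S (f : A -> nat) : recursive f -> recursive (fun a => S (f a)).
Proof.
intros [g [Hg Eg]]; exists (fun x => S (g x)); split.
- apply (nat_recursive_comp S); auto using nat_recursive_succ.
- intros a; now rewrite Eg.
Qed.

(** Pairs of numbers are coded by the Cantor pairing itself, so on codes both directions of the
    bijection are the identity. *)
Lemma rec_to_nat (f : A -> nat * nat) :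
  recursive f -> recursive (fun a => Cantor.to_nat (f a)).
Proof.
intros [g [Hg Eg]]; exists g; split; auto.
intros a; rewrite Eg; unfold enc, enc_prod, enc; now destruct (f a).
Qed.

Lemma rec_of_nat (f : A -> nat) :
  recursive f -> recursive (fun a => Cantor.of_nat (f a)).
Proof.
intros [g [Hg Eg]]; exists g; split; auto.
intros a; rewrite Eg; exact (eq_sym (pair_pi _)).
Qed.

Lemma rec_nat_match (n : A -> nat) (f : A -> B) (g : A -> nat -> B) :
  recursive n -> recursive f -> recursive (fun z => g (fst z) (snd z)) ->
  recursive (fun a => match n a with 0 => f a | S k => g a k end).
Proof.
intros [n' [Hn En]] [f' [Hf Ef]] [g' [Hg Eg]].
exists (fun x => match n' x with 0 => f' x | S k => g' ⟨x, k⟩ end); split.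
- eapply nat_recursive_ext; [|eapply nat_recursive_comp;
    [apply (nat_recursive_case f' g' Hf Hg)|
     apply (nat_recursive_pair _ n' nat_recursive_id Hn)]].
  intros x; cbn beta; now rewrite pi1_pair, pi2_pair.
- intros a; rewrite En; change (enc (n a)) with (n a).
  destruct (n a) as [|k]; auto; apply (Eg (a, k)).
Qed.

Lemma rec_if (b : A -> bool) (f g : A -> B) :
  recursive b -> recursive f -> recursive g ->
  recursive (fun a => if b a then f a else g a).
Proof.
intros Hb Hf Hg.
assert (Hb' : recursive (fun a => Nat.b2n (b a))).
{ destruct Hb as [b' [Hb Eb]]; exists b'; auto. }
apply (rec_ext (fun a => match Nat.b2n (b a) with 0 => g a | S _ => f a end)).
- intros a; now destruct (b a).
- apply (rec_nat_match _ g (fun a _ => f a)); auto.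
  destruct Hf as [f' [Hf Ef]]; exists (fun x => f' (pi1 x)); split.
  + apply nat_recursive_comp; auto using nat_recursive_fst.
  + intros [a k]; unfold enc at 1, enc_prod; now rewrite pi1_pair, Ef.
Qed.

Lemma rec_iter (n : A -> nat) (g : A -> B -> B) (f : A -> B) :
  recursive n -> recursive (fun z => g (fst z) (snd z)) -> recursive f ->
  recursive (fun a => Nat.iter (n a) (g a) (f a)).
Proof.
intros [n' [Hn En]] [g' [Hg Eg]] [f' [Hf Ef]].
exists (fun x => nat_rect (fun _ => nat) (f' x) (fun _ y => g' ⟨x, y⟩) (n' x)).
split.
- assert (Hg' : nat_recursive (fun z => g' ⟨pi1 z, pi2 (pi2 z)⟩)).
  { apply nat_recursive_comp; auto.
    apply nat_recursive_pair; [apply nat_recursive_fst|].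
    apply (nat_recursive_comp (fun x => pi2 x)); apply nat_recursive_snd. }
  eapply nat_recursive_ext; [|eapply nat_recursive_comp;
    [apply (nat_recursive_prec f' _ Hf Hg')|
     apply (nat_recursive_pair _ n' nat_recursive_id Hn)]].
  intros x; cbn beta; rewrite pi1_pair, pi2_pair.
  induction (n' x) as [|k IH]; cbn; [reflexivity|].
  now rewrite IH, pi1_pair, !pi2_pair.
- intros a; rewrite En; change (enc (n a)) with (n a).
  induction (n a) as [|k IH]; cbn; [apply Ef|].
  rewrite IH; apply (Eg (a, _)).
Qed.

End Closure.

Section Closure_list.
Context {A B C : Type} `{EA : Enc A} `{EB : Enc B} `{EC : Enc C}.

Lemma rec_Some (f : A -> B) : recursive f -> recursive (fun a => Some (f a)).
Proof.
intros [g [Hg Eg]]; exists (fun x => S (g x)); split.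
- apply (nat_recursive_comp S); auto using nat_recursive_succ.
- intros a; now rewrite Eg.
Qed.

Lemma rec_option_match (o : A -> option B) (f : A -> C) (g : A -> B -> C) :
  recursive o -> recursive f -> recursive (fun z => g (fst z) (snd z)) ->
  recursive (fun a => match o a with None => f a | Some b => g a b end).
Proof.
intros [n' [Hn En]] [f' [Hf Ef]] [g' [Hg Eg]].
exists (fun x => match n' x with 0 => f' x | S k => g' ⟨x, k⟩ end); split.
- eapply nat_recursive_ext; [|eapply nat_recursive_comp;
    [apply (nat_recursive_case f' g' Hf Hg)|
     apply (nat_recursive_pair _ n' nat_recursive_id Hn)]].
  intros x; cbn beta; now rewrite pi1_pair, pi2_pair.
- intros a; rewrite En.
  destruct (o a) as [b|]; [apply (Eg (a, b))|apply Ef].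
Qed.

Lemma rec_cons (f : A -> B) (g : A -> list B) :
  recursive f -> recursive g -> recursive (fun a => f a :: g a).
Proof.
intros [f' [Hf Ef]] [g' [Hg Eg]]; exists (fun x => S ⟨f' x, g' x⟩); split.
- apply (nat_recursive_comp S); [apply nat_recursive_succ|].
  now apply nat_recursive_pair.
- intros a; now rewrite Ef, Eg.
Qed.

Lemma rec_list_match (l : A -> list B) (f : A -> C) (g : A -> B -> list B -> C) :
  recursive l -> recursive f ->
  recursive (fun z => g (fst z) (fst (snd z)) (snd (snd z))) ->
  recursive (fun a => match l a with nil => f a | b :: t => g a b t end).
Proof.
intros [n' [Hn En]] [f' [Hf Ef]] [g' [Hg Eg]].
exists (fun x => match n' x with 0 => f' x | S k => g' ⟨x, k⟩ end); split.
- eapply nat_recursive_ext; [|eapply nat_recursive_comp;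
    [apply (nat_recursive_case f' g' Hf Hg)|
     apply (nat_recursive_pair _ n' nat_recursive_id Hn)]].
  intros x; cbn beta; now rewrite pi1_pair, pi2_pair.
- intros a; rewrite En.
  destruct (l a) as [|b t]; [apply Ef|apply (Eg (a, (b, t)))].
Qed.

End Closure_list.

Lemma rec_comp2 {A B C D} `{Enc A} `{Enc B} `{Enc C} `{Enc D}
  (F : B -> C -> D) (f : A -> B) (g : A -> C) :
  recursive (fun z => F (fst z) (snd z)) -> recursive f -> recursive g ->
  recursive (fun a => F (f a) (g a)).
Proof.
intros HF Hf Hg; apply (rec_comp (fun z => F (fst z) (snd z)) (fun a => (f a, g a)) HF).
now apply rec_pair.
Qed.

Lemma rec_comp3 {A B C D E} `{Enc A} `{Enc B} `{Enc C} `{Enc D} `{Enc E}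
  (F : B -> C -> D -> E) (f : A -> B) (g : A -> C) (h : A -> D) :
  recursive (fun z => F (fst (fst z)) (snd (fst z)) (snd z)) ->
  recursive f -> recursive g -> recursive h ->
  recursive (fun a => F (f a) (g a) (h a)).
Proof.
intros HF Hf Hg Hh.
apply (rec_comp (fun z => F (fst (fst z)) (snd (fst z)) (snd z))
  (fun a => (f a, g a, h a)) HF).
now repeat apply rec_pair.
Qed.

Create HintDb recursive.

(** Allows the code of a list to serve as the number of rounds of a loop over it. *)
Lemma length_enc {A} `{Enc A} (l : list A) : length l <= enc l.
Proof.
induction l as [|a l IH]; cbn; [lia|].
change (S (length l) <= S ⟨enc a, enc l⟩).
pose proof (pair_ge (enc a) (enc l)); lia.
Qed.

(** The fold becomes an iteration on the pair of the remaining list and the accumulator; once the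
    list is exhausted, the surplus rounds change nothing. *)
Lemma rec_fold_left {A B C} `{Enc A} `{Enc B} `{Enc C}
  (g : A -> C -> B -> C) (l : A -> list B) (i : A -> C) :
  recursive (fun z => g (fst (fst z)) (snd (fst z)) (snd z)) ->
  recursive l -> recursive i ->
  recursive (fun a => fold_left (g a) (l a) (i a)).
Proof.
intros Hg Hl Hi.
set (step := fun a (z : list B * C) =>
  match fst z with nil => z | b :: t => (t, g a (snd z) b) end).
apply (rec_ext (fun a => snd (Nat.iter (enc (l a)) (step a) (l a, i a)))).
- intros a; pose proof (length_enc (l a)) as Hn.
  generalize dependent (enc (l a)); generalize (i a); induction (l a) as [|b t IH].
  + intros c n _; induction n as [|n IHn]; [reflexivity|].
    rewrite Nat.iter_succ_r; exact IHn.
  + intros c [|n] Hn; cbn in Hn; [lia|].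
    rewrite Nat.iter_succ_r; apply IH; lia.
- apply rec_snd, rec_iter; [destruct Hl as [f Hf]; now exists f| |now apply rec_pair].
  unfold step.
  apply (rec_list_match (fun z => fst (snd z)) (fun z => snd z)
    (fun z b t => (t, g (fst z) (snd (snd z)) b)));
    [apply rec_fst, rec_snd, rec_id|apply rec_snd, rec_id|].
  apply rec_pair; [apply rec_snd, rec_snd, rec_id|].
  apply (rec_comp3 g); [assumption| | |].
  + apply rec_fst, rec_fst, rec_id.
  + apply rec_snd, rec_snd, rec_fst, rec_id.
  + apply rec_fst, rec_snd, rec_id.
Qed.

Section List_functions.
Context {A B : Type} `{EA : Enc A} `{EB : Enc B}.
Variables (f : A -> B -> bool) (l : A -> list B).
Hypotheses (Hf : recursive (fun z => f (fst z) (snd z))) (Hl : recursive l).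

Let Hf' C `{Enc C} : recursive (fun z : A * C * B => f (fst (fst z)) (snd z)).
Proof.
apply (rec_comp2 f); [assumption|apply rec_fst, rec_fst, rec_id|apply rec_snd, rec_id].
Qed.

Lemma rec_existsb : recursive (fun a => existsb (f a) (l a)).
Proof.
apply (rec_ext (fun a =>
  fold_left (fun acc b => if f a b then true else acc) (l a) false)).
- intros a.
  enough (E : forall acc, fold_left (fun acc b => if f a b then true else acc) (l a) acc
    = acc || existsb (f a) (l a)) by apply E.
  induction (l a) as [|b t IH]; intros acc; cbn; [now rewrite orb_false_r|].
  rewrite IH; now destruct (f a b), acc.
- apply rec_fold_left; auto using rec_const.
  apply rec_if; [apply Hf'|apply rec_const|apply rec_snd, rec_fst, rec_id].
Qed.

Lemma rec_forallb : recursive (fun a => forallb (f a) (l a)).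
Proof.
apply (rec_ext (fun a =>
  fold_left (fun acc b => if f a b then acc else false) (l a) true)).
- intros a.
  enough (E : forall acc, fold_left (fun acc b => if f a b then acc else false) (l a) acc
    = acc && forallb (f a) (l a)) by apply E.
  induction (l a) as [|b t IH]; intros acc; cbn; [now rewrite andb_true_r|].
  rewrite IH; now destruct (f a b), acc.
- apply rec_fold_left; auto using rec_const.
  apply rec_if; [apply Hf'|apply rec_snd, rec_fst, rec_id|apply rec_const].
Qed.

Lemma rec_find : recursive (fun a => find (f a) (l a)).
Proof.
apply (rec_ext (fun a => fold_left (fun acc b =>
  match acc with
  | None => if f a b then Some b else None
  | Some c => Some c
  end) (l a) None)).
- intros a; induction (l a) as [|b t IH]; cbn; [reflexivity|].
  destruct (f a b); [|exact IH].
  clear IH; induction t; auto.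
- apply rec_fold_left; auto using rec_const.
  apply (rec_option_match (fun z : A * option B * B => snd (fst z))
    (fun z => if f (fst (fst z)) (snd z) then Some (snd z) else None)
    (fun _ c => Some c)).
  + apply rec_snd, rec_fst, rec_id.
  + apply rec_if; [apply Hf'|apply rec_Some, rec_snd, rec_id|apply rec_const].
  + apply rec_Some, rec_snd, rec_id.
Qed.

Lemma rec_rev : recursive (fun a => rev (l a)).
Proof.
apply (rec_ext (fun a => fold_left (fun acc b => b :: acc) (l a) nil)).
- intros a.
  enough (E : forall acc, fold_left (fun acc b => b :: acc) (l a) acc
    = rev (l a) ++ acc) by (rewrite E; apply app_nil_r).
  induction (l a) as [|b t IH]; intros acc; cbn; [reflexivity|].
  now rewrite IH, <- app_assoc.
- apply (rec_fold_left (fun _ acc b => b :: acc)); auto using rec_const.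
  apply rec_cons; [apply rec_snd, rec_id|apply rec_snd, rec_fst, rec_id].
Qed.

End List_functions.

Lemma rec_filter {A B} `{Enc A} `{Enc B} (f : A -> B -> bool) (l : A -> list B) :
  recursive (fun z => f (fst z) (snd z)) -> recursive l ->
  recursive (fun a => filter (f a) (l a)).
Proof.
intros Hf Hl.
apply (rec_ext (fun a =>
  rev (fold_left (fun acc b => if f a b then b :: acc else acc) (l a) nil))).
- intros a.
  enough (E : forall acc,
    rev (fold_left (fun acc b => if f a b then b :: acc else acc) (l a) acc)
    = rev acc ++ filter (f a) (l a)) by apply E.
  induction (l a) as [|b t IH]; intros acc; cbn; [now rewrite app_nil_r|].
  rewrite IH; destruct (f a b); cbn; [now rewrite <- app_assoc|reflexivity].
- apply rec_rev, rec_fold_left; auto using rec_const.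
  apply rec_if; [|apply rec_cons|];
    [|apply rec_snd, rec_id|apply rec_snd, rec_fst, rec_id..].
  apply (rec_comp2 f); [assumption|apply rec_fst, rec_fst, rec_id|apply rec_snd, rec_id].
Qed.

(** * Automation and basic arithmetic *)

(** Syntax-directed; defined functions are looked up in the hint database [recursive], those of
    several arguments in uncurried form. *)
Ltac rec_step :=
  cbv beta zeta;
  match goal with
  | H : recursive ?f |- recursive ?f => exact H
  | |- recursive (fun a => a) => apply rec_id
  | |- recursive fst => apply (rec_fst _ rec_id)
  | |- recursive snd => apply (rec_snd _ rec_id)
  | |- recursive S => apply (rec_S _ rec_id)
  | |- recursive (fun _ => ?b) => apply rec_const
  | |- recursive (fun a => (@?f a, @?g a)) => apply (rec_pair f g)
  | |- recursive (fun a => fst (@?f a)) => apply (rec_fst f)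
  | |- recursive (fun a => snd (@?f a)) => apply (rec_snd f)
  | |- recursive (fun a => S (@?f a)) => apply (rec_S f)
  | |- recursive (fun a => Cantor.to_nat (@?f a)) => apply (rec_to_nat f)
  | |- recursive (fun a => Cantor.of_nat (@?f a)) => apply (rec_of_nat f)
  | |- recursive (fun a => Some (@?f a)) => apply (rec_Some f)
  | |- recursive (fun a => @?f a :: @?g a) => apply (rec_cons f g)
  | |- recursive (fun a => if @?b a then @?f a else @?g a) => apply (rec_if b f g)
  | |- recursive (fun a => match @?n a with 0 => @?f a | S k => @?g a k end) =>
      apply (rec_nat_match n f g)
  | |- recursive (fun a => match @?o a with None => @?f a | Some b => @?g a b end) =>
      apply (rec_option_match o f g)
  | |- recursive (fun a => match @?l a with nil => @?f a | b :: t => @?g a b t end) =>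
      apply (rec_list_match l f g)
  | |- recursive (fun a => Nat.iter (@?n a) (@?g a) (@?f a)) =>
      apply (rec_iter n g f)
  | |- recursive (fun a => fold_left (@?g a) (@?l a) (@?i a)) =>
      apply (rec_fold_left g l i)
  | |- recursive (fun a => existsb (@?f a) (@?l a)) => apply (rec_existsb f l)
  | |- recursive (fun a => forallb (@?f a) (@?l a)) => apply (rec_forallb f l)
  | |- recursive (fun a => filter (@?f a) (@?l a)) => apply (rec_filter f l)
  | |- recursive (fun a => find (@?f a) (@?l a)) => apply (rec_find f l)
  | |- recursive (fun a => ?F (@?f a) (@?g a) (@?h a)) =>
      apply (rec_comp3 F f g h); [solve [eauto with recursive nocore]| | |]
  | |- recursive (fun a => ?F (@?f a) (@?g a)) =>
      apply (rec_comp2 F f g); [solve [eauto with recursive nocore]| |]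
  | |- recursive (fun a => ?F (@?f a)) =>
      apply (rec_comp F f); [solve [eauto with recursive nocore]|]
  end.

Ltac rec_auto := repeat rec_step.

Lemma rec_pred : recursive Nat.pred.
Proof. apply (rec_ext (fun n => match n with 0 => 0 | S k => k end));
  [now intros []|rec_auto]. Qed.

Lemma rec_add : recursive (fun z => fst z + snd z).
Proof.
apply (rec_ext (fun z => Nat.iter (fst z) S (snd z))); [|rec_auto].
intros [m n]; cbn; induction m; cbn; auto.
Qed.

Lemma rec_sub : recursive (fun z => fst z - snd z).
Proof.
apply (rec_ext (fun z => Nat.iter (snd z) Nat.pred (fst z))).
- intros [m n]; cbn; induction n; cbn; [lia|]; rewrite IHn; lia.
- apply (rec_iter (fun z => snd z) (fun _ => Nat.pred)); [rec_auto| |rec_auto].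
  apply (rec_comp Nat.pred); [apply rec_pred|rec_auto].
Qed.
#[export] Hint Resolve rec_pred rec_add rec_sub : recursive.

Lemma rec_negb : recursive negb.
Proof. unfold negb; rec_auto. Qed.

Lemma rec_andb : recursive (fun z => fst z && snd z).
Proof. unfold andb; rec_auto. Qed.

Lemma rec_orb : recursive (fun z => fst z || snd z).
Proof. unfold orb; rec_auto. Qed.

Lemma rec_leb : recursive (fun z => fst z <=? snd z).
Proof.
apply (rec_ext (fun z => match fst z - snd z with 0 => true | S _ => false end));
  [|rec_auto].
intros [m n]; cbn [fst snd]; destruct (Nat.leb_spec m n), (m - n) eqn:?; auto; lia.
Qed.
#[export] Hint Resolve rec_negb rec_andb rec_orb rec_leb : recursive.

Lemma rec_eqb : recursive (fun z => fst z =? snd z).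
Proof.
apply (rec_ext (fun z => (fst z <=? snd z) && (snd z <=? fst z))); [|rec_auto].
intros [m n]; cbn [fst snd].
destruct (Nat.leb_spec m n), (Nat.leb_spec n m), (Nat.eqb_spec m n); auto; lia.
Qed.

Lemma rec_ltb : recursive (fun z => fst z <? snd z).
Proof. unfold Nat.ltb; rec_auto. Qed.

Lemma rec_max : recursive (fun z => Nat.max (fst z) (snd z)).
Proof.
apply (rec_ext (fun z => fst z + (snd z - fst z))); [|rec_auto].
intros [m n]; cbn [fst snd]; lia.
Qed.

Lemma rec_eqb_bool : recursive (fun z => Bool.eqb (fst z) (snd z)).
Proof. unfold Bool.eqb; rec_auto. Qed.

Lemma rec_seq : recursive (fun n => seq 0 n).
Proof.
apply (rec_ext (fun n =>
  snd (Nat.iter n (fun z => (Nat.pred (fst z), Nat.pred (fst z) :: snd z)) (n, nil))));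
  [|rec_auto].
intros n.
enough (E : forall i, i <= n ->
  Nat.iter i (fun z => (Nat.pred (fst z), Nat.pred (fst z) :: snd z)) (n, nil)
  = (n - i, seq (n - i) i)) by (rewrite E; [now rewrite Nat.sub_diag|lia]).
induction i as [|i IH]; intros Hi; [cbn; now rewrite Nat.sub_0_r|].
rewrite Nat.iter_succ, IH by lia; cbn.
replace (n - i) with (S (n - S i)) by lia; reflexivity.
Qed.
#[export] Hint Resolve rec_eqb rec_ltb rec_max rec_eqb_bool rec_seq : recursive.

(** * Unbounded search *)

(** The same program serves two purposes: its domain is an r.e. set, and where the search always
    succeeds it is a total function that can be used inside reductions, because it makes no
    query. *)
Lemma search_prog (P : nat -> nat -> bool) :
  recursive (fun z => P (fst z) (snd z)) ->
  exists p, (forall O x y u, eval O p x y u -> P x y = true) /\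
    forall x n, P x n = true -> exists m, P x m = true /\ forall O, eval O p x m 0.
Proof.
intros HP.
assert (HP' : recursive (fun z => if P (fst z) (snd z) then 0 else 1)) by rec_auto.
destruct HP' as [g [[q Hq] Eg]].
assert (Hq' : forall O x n, eval O q ⟨x, n⟩ (if P x n then 0 else 1) 0).
{ intros O x n; specialize (Hq O ⟨x, n⟩).
  now rewrite (Eg (x, n) : g ⟨x, n⟩ = if P x n then 0 else 1) in Hq. }
exists (Comp (Mu q) (Pair id_prog Zero)); split.
- intros O x y u E; apply eval_inv in E as [z [v [w [Ez [Ey _]]]]].
  assert (z = ⟨x, 0⟩) as ->.
  { apply (eval_det _ _ _ _ _ Ez _ 0), (eval_pair O id_prog Zero _ _ _ 0 0);
      [apply eval_id|constructor]. }
  remember ⟨x, 0⟩ as z eqn:Hz; remember (Mu q) as p eqn:Hp.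
  clear Ez; revert Hz; generalize 0 as n.
  induction Ey; intros n' Hz; try discriminate; injection Hp as ->;
    apply pair_inj in Hz as [-> ->]; [|eapply IHEy2; eauto].
  apply (eval_det _ _ _ _ _ (Hq' O x n')) in Ey as [Ey _].
  now destruct (P x n').
- intros x n Hn.
  (* Downward induction from the known solution [n]: the search succeeds when started at [n - k]. *)
  assert (H : forall k, k <= n ->
    exists m, P x m = true /\ forall O, eval O (Mu q) ⟨x, n - k⟩ m 0).
  { induction k as [|k IH]; intros Hk.
    - exists n; split; [assumption|intros O].
      rewrite Nat.sub_0_r; constructor.
      specialize (Hq' O x n); now rewrite Hn in Hq'.
    - destruct (P x (n - S k)) eqn:Ek.
      + exists (n - S k); split; [assumption|intros O; constructor].
        specialize (Hq' O x (n - S k)); now rewrite Ek in Hq'.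
      + destruct IH as [m [Hm Em]]; [lia|].
        exists m; split; [assumption|intros O].
        specialize (Hq' O x (n - S k)); rewrite Ek in Hq'.
        apply (eval_mu_next O q x _ 0 m 0 0 Hq').
        replace (S (n - S k)) with (n - k) by lia; apply Em. }
  destruct (H n) as [m [Hm Em]]; [lia|].
  exists m; split; [assumption|intros O].
  rewrite Nat.sub_diag in Em.
  apply (eval_comp O (Mu q) _ x ⟨x, 0⟩ _ 0 0), Em.
  apply (eval_pair O id_prog Zero _ _ _ 0 0); [apply eval_id|constructor].
Qed.

Lemma rec_search (P : nat -> nat -> bool) :
  recursive (fun z => P (fst z) (snd z)) ->
  (forall x, exists n, P x n = true) ->
  exists g, recursive g /\ forall x, P x (g x) = true.
Proof.
intros HP Hex; destruct (search_prog P HP) as [p [_ Hp]].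
assert (H : forall x, {m | P x m = true /\ forall O, eval O p x m 0}).
{ intros x; apply constructive_indefinite_description.
  destruct (Hex x) as [n Hn]; eauto. }
exists (fun x => proj1_sig (H x)); split.
- exists (fun x => proj1_sig (H x)); split; [|reflexivity].
  exists p; intros O x; apply (proj2_sig (H x)).
- intros x; apply (proj2_sig (H x)).
Qed.

(** * Substituting a program for the oracle *)

Fixpoint subst (q p : prog) : prog :=
  match p with
  | Query => q
  | Pair f g => Pair (subst q f) (subst q g)
  | Comp f g => Comp (subst q f) (subst q g)
  | Prec f g => Prec (subst q f) (subst q g)
  | Mu f => Mu (subst q f)
  | p => p
  end.

Definition sup (h : nat -> nat) (n : nat) : nat :=
  fold_left (fun m z => Nat.max m (h z)) (seq 0 n) 0.

Lemma sup_S h n : sup h (S n) = Nat.max (sup h n) (h n).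
Proof. unfold sup; now rewrite seq_S, fold_left_app. Qed.

Lemma sup_le h m n : m <= n -> sup h m <= sup h n.
Proof. induction 1; rewrite ?sup_S; lia. Qed.

Lemma eval_subst B C q h :
  (forall z, exists y v, eval C q z y v /\ char_val B z y /\ v <= h z) ->
  forall p x y u, eval B p x y u ->
  exists v, eval C (subst q p) x y v /\ v <= sup h u.
Proof.
intros Hq p x y u E.
induction E; cbn [subst];
  repeat match goal with IH : exists v, _ |- _ => destruct IH as [? [? ?]] end;
  repeat match goal with |- context [sup h (Nat.max ?u ?v)] =>
    pose proof (sup_le h _ _ (Nat.le_max_l u v));
    pose proof (sup_le h _ _ (Nat.le_max_r u v));
    generalize dependent (sup h (Nat.max u v)); intros
  end;
  try (eexists; split; [econstructor; eassumption|lia]);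
  destruct (Hq x) as [y [v [Hy [Hc Hv]]]];
  exists v; rewrite sup_S; (split; [|lia]);
  now destruct Hc as [[? ->]|[? ->]].
Qed.

Lemma rec_sup {A} `{Enc A} (h : nat -> nat) (n : A -> nat) :
  recursive h -> recursive n -> recursive (fun a => sup h (n a)).
Proof.
intros Hh Hn; unfold sup; rec_auto.
Qed.

(** The characteristic function of the empty oracle is constantly 0, so substituting [Zero] for
    [Query] gives a program that behaves alike under every oracle; its use is bounded by a supremum
    of zeros. *)
Lemma computable_iff f : computable f <-> recursive f.
Proof.
split.
- intros [p Hp]; exists f; split; [|reflexivity].
  exists (subst Zero p); intros O x.
  destruct (Hp x) as [u Hu].
  assert (Hz : forall z, exists y v,
    eval O Zero z y v /\ char_val no_oracle z y /\ v <= 0).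
  { intros z; exists 0, 0; repeat split; [constructor|right; now split|lia]. }
  destruct (eval_subst no_oracle O Zero (fun _ => 0) Hz _ _ _ _ Hu) as [v [Hv Lv]].
  replace v with 0 in Hv; [exact Hv|].
  enough (sup (fun _ => 0) u = 0) by lia.
  clear; induction u; rewrite ?sup_S; [reflexivity|lia].
- intros [g [[p Hp] E]]; exists p; intros x; exists 0.
  rewrite <- (E x : g x = f x); apply Hp.
Qed.

Lemma wtt_le_refl A : wtt_le A A.
Proof.
exists Query, S; split; [apply computable_iff; rec_auto|].
intros x; destruct (classic (A x)) as [Hx|Hx].
- exists 1, (S x); repeat split; [now constructor|now left|lia].
- exists 0, (S x); repeat split; [now constructor|now right|lia].
Qed.

Lemma wtt_le_trans A B C : wtt_le A B -> wtt_le B C -> wtt_le A C.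
Proof.
intros [p [h [Hh Hp]]] [q [k [Hk Hq]]].
apply computable_iff in Hh, Hk.
exists (subst q p), (fun x => sup k (h x)); split.
- apply computable_iff, rec_sup; assumption.
- intros x; destruct (Hp x) as [y [u [Hy [Hc Hu]]]].
  destruct (eval_subst B C q k Hq _ _ _ _ Hy) as [v [Hv Lv]].
  exists y, v; repeat split; auto.
  pose proof (sup_le k _ _ Hu); lia.
Qed.

(** * An abstract machine for programs *)

Definition divmod4 (n : nat) : nat * nat :=
  Nat.iter n (fun z => if snd z =? 3 then (S (fst z), 0) else (fst z, S (snd z)))
    (0, 0).

Lemma divmod4_spec n : n = 4 * fst (divmod4 n) + snd (divmod4 n) /\ snd (divmod4 n) < 4.
Proof.
unfold divmod4; induction n as [|n IH]; [cbn; lia|].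
rewrite Nat.iter_succ; destruct (Nat.iter n _ _) as [q r]; cbn [fst snd] in *.
destruct (Nat.eqb_spec r 3); cbn [fst snd]; lia.
Qed.

(** Inverts [code]: the tag, from 0 to 8, numbers the constructors of [prog] in order, and the
    payload codes the arguments. *)
Definition tag (n : nat) : nat := if n <? 5 then n else 5 + snd (divmod4 (n - 5)).
Definition payload (n : nat) : nat := fst (divmod4 (n - 5)).

Lemma tag_payload k q r : k = 5 + r + 4 * q -> r < 4 -> tag k = 5 + r /\ payload k = q.
Proof.
intros -> Hr; unfold tag, payload.
destruct (Nat.ltb_spec (5 + r + 4 * q) 5); [lia|].
pose proof (divmod4_spec (5 + r + 4 * q - 5)); lia.
Qed.

(** A frame [(t, (p, x))] is a pending operation: its kind [t], a program code
    and an argument. In a state [(b, (p, x), (K, u))] the program [p] is to be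
    run on [x] if [b] holds, and the value [x] is being returned to the stack
    [K] otherwise; [u] is the use so far. *)
Notation frame := (nat * (nat * nat))%type.
Notation state := ((bool * (nat * nat)) * (list frame * nat))%type.

Definition call (p x : nat) (K : list frame) (u : nat) : state :=
  ((true, (p, x)), (K, u)).
Definition ret (y : nat) (K : list frame) (u : nat) : state :=
  ((false, (0, y)), (K, u)).

Definition step_call (o : nat -> bool) (p x : nat) (K : list frame) (u : nat) : state :=
  if tag p =? 0 then ret 0 K u
  else if tag p =? 1 then ret (S x) K u
  else if tag p =? 2 then ret (pi1 x) K u
  else if tag p =? 3 then ret (pi2 x) K u
  else if tag p =? 4 then ret (if o x then 1 else 0) K (Nat.max u (S x))
  else if tag p =? 5 then call (pi1 (payload p)) x ((0, (pi2 (payload p), x)) :: K) u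
  else if tag p =? 6 then call (pi2 (payload p)) x ((2, (pi1 (payload p), 0)) :: K) u
  else if tag p =? 7 then
    match pi2 x with
    | 0 => call (pi1 (payload p)) (pi1 x) K u
    | S n => call p ⟨pi1 x, n⟩ ((3, (pi2 (payload p), ⟨pi1 x, n⟩)) :: K) u
    end
  else call (payload p) x ((4, (p, x)) :: K) u.

(** Kinds 0 and 1 wait for the first and the second component of a [Pair], kind 2 for the inner
    value of a [Comp], kind 3 for the previous value of a [Prec], and kind 4 for the test of a [Mu].
    In kind 1 the argument slot keeps the first component. *)
Definition resume (y t p x : nat) (K : list frame) (u : nat) : state :=
  if t =? 0 then call p x ((1, (0, y)) :: K) u
  else if t =? 1 then ret ⟨x, y⟩ K u
  else if t =? 2 then call p y K u
  else if t =? 3 then call p ⟨pi1 x, ⟨pi2 x, y⟩⟩ K u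
  else match y with
       | 0 => ret (pi2 x) K u
       | S _ => call p ⟨pi1 x, S (pi2 x)⟩ K u
       end.

Definition step (o : nat -> bool) (s : state) : state :=
  if fst (fst s)
  then step_call o (fst (snd (fst s))) (snd (snd (fst s))) (fst (snd s)) (snd (snd s))
  else match fst (snd s) with
       | [] => s
       | F :: K => resume (snd (snd (fst s))) (fst F) (fst (snd F)) (snd (snd F)) K (snd (snd s))
       end.

Definition run (o : nat -> bool) (n p x : nat) : option (nat * nat) :=
  let s := Nat.iter n (step o) (call p x [] 0) in
  if fst (fst s) then None
  else match fst (snd s) with
       | [] => Some (snd (snd (fst s)), snd (snd s))
       | _ :: _ => None
       end.

Lemma step_call_code o p x K u :
  step o (call (code p) x K u) =
  match p with
  | Zero => ret 0 K u
  | Succ => ret (S x) K u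
  | Fst => ret (pi1 x) K u
  | Snd => ret (pi2 x) K u
  | Query => ret (if o x then 1 else 0) K (Nat.max u (S x))
  | Pair f g => call (code f) x ((0, (code g, x)) :: K) u
  | Comp f g => call (code g) x ((2, (code f, 0)) :: K) u
  | Prec f g =>
      match pi2 x with
      | 0 => call (code f) (pi1 x) K u
      | S n => call (code p) ⟨pi1 x, n⟩ ((3, (code g, ⟨pi1 x, n⟩)) :: K) u
      end
  | Mu f => call (code f) x ((4, (code p, x)) :: K) u
  end.
Proof.
change (step o (call (code p) x K u)) with (step_call o (code p) x K u).
destruct p as [| | | | |f g|f g|f g|f]; try reflexivity; unfold step_call;
  [destruct (tag_payload (code (Pair f g)) ⟨code f, code g⟩ 0) as [-> ->]
  |destruct (tag_payload (code (Comp f g)) ⟨code f, code g⟩ 1) as [-> ->]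
  |destruct (tag_payload (code (Prec f g)) ⟨code f, code g⟩ 2) as [-> ->]
  |destruct (tag_payload (code (Mu f)) (code f) 3) as [-> ->]];
  try (cbn [code]; lia); cbn [Nat.eqb Nat.add]; rewrite ?pi1_pair, ?pi2_pair;
  reflexivity.
Qed.

Definition agree (o : nat -> bool) (O : nat -> Prop) (u : nat) : Prop :=
  forall z, z < u -> (o z = true <-> O z).

Lemma agree_le o O u v : agree o O v -> u <= v -> agree o O u.
Proof. intros H L z Hz; apply H; lia. Qed.

Lemma iter_1 {A} (f : A -> A) a : Nat.iter 1 f a = f a.
Proof. reflexivity. Qed.

Lemma step_ret o y F K u :
  step o (ret y (F :: K) u) = resume y (fst F) (fst (snd F)) (snd (snd F)) K u.
Proof. reflexivity. Qed.

(** The number of steps is fixed before the Boolean oracle [o]: one bound has to serve for all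
    stagewise approximations that are correct below the use. *)
Lemma machine_complete O p x y u :
  eval O p x y u ->
  exists n, forall o, agree o O u -> forall K v,
    Nat.iter n (step o) (call (code p) x K v) = ret y K (Nat.max v u).
Proof.
assert (Hle : forall o O a b, agree o O (Nat.max a b) -> agree o O a /\ agree o O b).
{ intros; split; eapply agree_le; eauto; lia. }
(* The step counts read from right to left: one step for the call, the run of the first subprogram,
   one step to resume its frame, and so on. *)
intros E; induction E;
  try destruct IHE as [n1 H1]; try destruct IHE1 as [n1 H1];
  try destruct IHE2 as [n2 H2];
  [exists 1|exists 1|exists 1|exists 1|exists 1|exists 1
  |exists (1 + (n2 + (1 + (n1 + 1))))|exists (n2 + (1 + (n1 + 1)))
  |exists (n1 + 1)|exists (n2 + (1 + (n1 + 1)))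
  |exists (1 + (n1 + 1))|exists (n2 + (1 + (n1 + 1)))];
  intros o Ho K w; try apply Hle in Ho as [Ho1 Ho2];
  rewrite ?Nat.iter_add, ?iter_1, step_call_code;
  rewrite ?pi1_pair, ?pi2_pair, ?Nat.max_0_r, ?Nat.max_assoc; try reflexivity;
  try (rewrite H1 by assumption; rewrite ?step_ret; cbn [fst snd];
       cbv beta iota delta [resume]; cbn [Nat.eqb]; rewrite ?pi1_pair, ?pi2_pair;
       try rewrite H2 by assumption; rewrite ?step_ret; reflexivity).
- now rewrite (proj2 (Ho x (Nat.lt_succ_diag_r x)) H).
- destruct (o x) eqn:Hx; [|reflexivity].
  now apply (Ho x (Nat.lt_succ_diag_r x)) in Hx.
Qed.

Definition halted (q y u : nat) : state := ((false, (q, y)), ([], u)).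

Lemma ret_frame_inv o m z F K v q y u :
  Nat.iter m (step o) (ret z (F :: K) v) = halted q y u ->
  exists m', m = S m' /\
    Nat.iter m' (step o) (resume z (fst F) (fst (snd F)) (snd (snd F)) K v) = halted q y u.
Proof.
destruct m as [|m]; [discriminate|].
rewrite Nat.iter_succ_r, step_ret; eauto.
Qed.

(** A halting run must empty the stack, so it passes through a return to [K]. Strictly fewer steps
    remain then, which lets strong induction treat the subcalls one after the other. *)
Lemma machine_sound o n : forall p x K v q y u,
  Nat.iter n (step o) (call (code p) x K v) = halted q y u ->
  exists z w m, m < n /\ eval (fun z => o z = true) p x z w /\
    Nat.iter m (step o) (ret z K (Nat.max v w)) = halted q y u.
Proof.
induction n as [n IH] using lt_wf_ind; intros p x K v q y u E.
destruct n as [|n]; [discriminate|].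
assert (IH1 : forall p x F K v,
  Nat.iter n (step o) (call (code p) x (F :: K) v) = halted q y u ->
  exists z w m, m < n /\ eval (fun z => o z = true) p x z w /\
    Nat.iter m (step o)
      (resume z (fst F) (fst (snd F)) (snd (snd F)) K (Nat.max v w)) = halted q y u).
{ intros p' x' F K' v' E'; apply IH in E' as [z [w [m [Hm [Ez E']]]]]; [|lia].
  apply ret_frame_inv in E' as [m' [-> E']].
  exists z, w, m'; repeat split; auto; lia. }
rewrite Nat.iter_succ_r, step_call_code in E.
destruct p as [| | | | |f g|f g|f g|f].
- exists 0, 0, n; rewrite Nat.max_0_r; repeat split; auto; constructor.
- exists (S x), 0, n; rewrite Nat.max_0_r; repeat split; auto; constructor.
- exists (pi1 x), 0, n; rewrite Nat.max_0_r; repeat split; auto.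
  rewrite <- (pair_pi x) at 1; constructor.
- exists (pi2 x), 0, n; rewrite Nat.max_0_r; repeat split; auto.
  rewrite <- (pair_pi x) at 1; constructor.
- exists (if o x then 1 else 0), (S x), n; repeat split; auto.
  destruct (o x) eqn:Hx; constructor; congruence.
- apply IH1 in E as [a [w [m [Hm [Ea E]]]]].
  change (Nat.iter m (step o) (call (code g) x ((1, (0, a)) :: K) (Nat.max v w))
    = halted q y u) in E.
  apply IH in E as [b [w' [m' [Hm' [Eb E]]]]]; [|lia].
  apply ret_frame_inv in E as [k [-> E]].
  exists ⟨a, b⟩, (Nat.max w w'), k; repeat split; [lia|econstructor; eassumption|].
  now rewrite Nat.max_assoc.
- apply IH1 in E as [z [w [m [Hm [Ez E]]]]].
  change (Nat.iter m (step o) (call (code f) z K (Nat.max v w)) = halted q y u) in E.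
  apply IH in E as [b [w' [m' [Hm' [Eb E]]]]]; [|lia].
  exists b, (Nat.max w w'), m'; repeat split; [lia|econstructor; eassumption|].
  now rewrite Nat.max_assoc.
- pose proof (pair_pi x) as Hx; destruct (pi2 x) as [|k] eqn:Hk.
  + apply IH in E as [b [w [m [Hm [Eb E]]]]]; [|lia].
    exists b, w, m; repeat split; [lia|rewrite <- Hx; now constructor|assumption].
  + apply IH1 in E as [z [w [m [Hm [Ez E]]]]].
    unfold resume in E; cbn [fst snd Nat.eqb] in E; rewrite pi1_pair, pi2_pair in E.
    change (Nat.iter m (step o) (call (code g) ⟨pi1 x, ⟨k, z⟩⟩ K (Nat.max v w))
      = halted q y u) in E.
    apply IH in E as [b [w' [m' [Hm' [Eb E]]]]]; [|lia].
    exists b, (Nat.max w w'), m'; repeat split; [lia| |now rewrite Nat.max_assoc].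
    rewrite <- Hx; econstructor; eassumption.
- pose proof (pair_pi x) as Hx; apply IH1 in E as [z [w [m [Hm [Ez E]]]]].
  cbn [fst snd] in E; destruct z as [|z].
  + exists (pi2 x), w, m; repeat split; [lia| |assumption].
    rewrite <- Hx at 1; constructor; now rewrite Hx.
  + change (Nat.iter m (step o) (call (code (Mu f)) ⟨pi1 x, S (pi2 x)⟩ K (Nat.max v w))
      = halted q y u) in E.
    apply IH in E as [b [w' [m' [Hm' [Eb E]]]]]; [|lia].
    exists b, (Nat.max w w'), m'; repeat split; [lia| |now rewrite Nat.max_assoc].
    rewrite <- Hx; apply (eval_mu_next _ f _ _ z); [now rewrite Hx|assumption].
Qed.

Lemma run_Some o n p x y u :
  run o n p x = Some (y, u) -> exists q, Nat.iter n (step o) (call p x [] 0)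
    = halted q y u.
Proof.
unfold run; destruct (Nat.iter _ _ _) as [[[] [q z]] [[|F K] v]]; cbn; try discriminate.
intros [= <- <-]; now exists q.
Qed.

(** Returning a value to the empty stack is a fixed point of [step]. *)
Lemma run_mono o m n p x r :
  m <= n -> run o m p x = Some r -> run o n p x = Some r.
Proof.
destruct r as [y u]; intros Hmn H; induction Hmn as [|n _ IH]; [assumption|].
apply run_Some in IH as [q Hq].
unfold run; now rewrite Nat.iter_succ, Hq.
Qed.

Lemma run_complete O p x y u :
  eval O p x y u ->
  exists m, forall n o, m <= n -> agree o O u -> run o n (code p) x = Some (y, u).
Proof.
intros E; destruct (machine_complete O p x y u E) as [m Hm].
exists m; intros n o Hn Ho; apply (run_mono o m n _ _ _ Hn).
unfold run; now rewrite (Hm o Ho).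
Qed.

Lemma run_sound o n p x y u :
  run o n (code p) x = Some (y, u) -> eval (fun z => o z = true) p x y u.
Proof.
intros E; apply run_Some in E as [q E].
apply machine_sound in E as [z [w [m [_ [Ez E]]]]].
assert (H : Nat.iter m (step o) (ret z [] w) = ret z [] w).
{ clear E; induction m as [|m IH]; [reflexivity|]. now rewrite Nat.iter_succ, IH. }
cbn [Nat.max] in E; rewrite H in E; now injection E as _ -> ->.
Qed.

Lemma rec_divmod4 : recursive divmod4.
Proof. unfold divmod4; rec_auto. Qed.
#[export] Hint Resolve rec_divmod4 : recursive.

Lemma rec_tag : recursive tag.
Proof. unfold tag; rec_auto. Qed.

Lemma rec_payload : recursive payload.
Proof. unfold payload; rec_auto. Qed.
#[export] Hint Resolve rec_tag rec_payload : recursive.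

Lemma rec_step_machine {A} `{Enc A} (o : A -> nat -> bool) (s : A -> state) :
  recursive (fun z => o (fst z) (snd z)) -> recursive s ->
  recursive (fun a => step (o a) (s a)).
Proof.
intros Ho Hs; unfold step, resume, step_call, call, ret; rec_auto.
Qed.

Lemma rec_run {A} `{Enc A} (o : A -> nat -> bool) (n p x : A -> nat) :
  recursive (fun z => o (fst z) (snd z)) ->
  recursive n -> recursive p -> recursive x ->
  recursive (fun a => run (o a) (n a) (p a) (x a)).
Proof.
intros Ho Hn Hp Hx; unfold run, call; rec_auto.
all: apply (rec_step_machine (fun z => o (fst z)) snd); rec_auto.
Qed.

Lemma eval_local O O' p x y u :
  eval O p x y u -> (forall z, z < u -> (O z <-> O' z)) -> eval O' p x y u.
Proof.
intros E; induction E; intros HO;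
  repeat match goal with
  | IH : (forall z, z < ?v -> _) -> _ |- _ =>
      specialize (IH (fun z Hz => HO z ltac:(lia)))
  end; try (econstructor; eassumption).
- apply eval_query_in, HO; auto.
- apply eval_query_out; now rewrite <- HO by auto.
Qed.

Lemma wtt_le_ext A B A' B' :
  (forall z, A z <-> A' z) -> (forall z, B z <-> B' z) -> wtt_le A B -> wtt_le A' B'.
Proof.
intros HA HB [p [h [Hh Hp]]]; exists p, h; split; [assumption|].
intros x; destruct (Hp x) as [y [u [Ey [Hy Hu]]]]; exists y, u; repeat split; auto.
- apply (eval_local B); auto.
- unfold char_val in *; now rewrite <- HA.
Qed.

(** * Weak truth-table reducibility is Sigma_3 *)

Definition W_stage (e s x : nat) : bool :=
  match run (fun _ => false) s e x with Some _ => true | None => false end.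

Lemma run_no_oracle_complete p x y u :
  eval no_oracle p x y u ->
  exists m, forall n, m <= n -> run (fun _ => false) n (code p) x = Some (y, u).
Proof.
intros E; apply run_complete in E as [m Hm]; exists m; intros n Hn.
apply Hm; [assumption|]; intros z _; split; [discriminate|intros []].
Qed.

Lemma run_no_oracle_sound n p x y u :
  run (fun _ => false) n (code p) x = Some (y, u) -> eval no_oracle p x y u.
Proof.
intros E; apply run_sound in E; apply (eval_local _ _ _ _ _ _ E).
intros z _; split; [discriminate|intros []].
Qed.

Lemma W_stage_mono e s t x : s <= t -> W_stage e s x = true -> W_stage e t x = true.
Proof.
unfold W_stage; intros Hst H; destruct (run _ s e x) as [r|] eqn:Er; [|discriminate].
now rewrite (run_mono _ _ _ _ _ _ Hst Er).
Qed.

Lemma W_iff e x : W e x <-> exists s, W_stage e s x = true.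
Proof.
unfold W_stage; split.
- intros [p [y [u [<- E]]]]; apply run_no_oracle_complete in E as [m Hm].
  exists m; now rewrite Hm.
- intros [s Hs]; destruct (run _ s e x) as [[y u]|] eqn:Er; [|discriminate].
  destruct (code_surj e) as [p <-]; apply run_no_oracle_sound in Er.
  now exists p, y, u.
Qed.

Lemma W_stage_agree e u : exists s, forall t, s <= t -> agree (W_stage e t) (W e) u.
Proof.
induction u as [|u [s Hs]]; [exists 0; intros t _ z Hz; lia|].
destruct (classic (W e u)) as [Hu|Hu].
- assert (Hu' := Hu); apply W_iff in Hu' as [s' Hs'].
  exists (Nat.max s s'); intros t Ht z Hz.
  destruct (Nat.eq_dec z u) as [->|]; [|apply Hs; lia].
  split; auto; intros _; apply (W_stage_mono e s'); auto; lia.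
- exists s; intros t Ht z Hz.
  destruct (Nat.eq_dec z u) as [->|]; [|apply Hs; lia].
  split; [intros H; apply W_iff; eauto|contradiction].
Qed.

(** The lower bound [t] on the stage turns [forall t, exists s] into an assertion about infinitely
    many stages. A run of [q] is included so that the condition also makes the bound total. *)
Definition wtt_stage (e i p q x t s : nat) : bool :=
  (t <=? s) &&
  match run (W_stage i s) s p x with
  | Some yu =>
      match run (fun _ => false) s q x with
      | Some mv =>
          (snd yu <=? fst mv) && (fst yu =? if W_stage e s x then 1 else 0)
      | None => false
      end
  | None => false
  end.

Lemma wtt_stage_spec e i p q x t s :
  wtt_stage e i (code p) (code q) x t s = true <->
  t <= s /\ exists y u m v, run (W_stage i s) s (code p) x = Some (y, u) /\
    run (fun _ => false) s (code q) x = Some (m, v) /\ u <= m /\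
    y = if W_stage e s x then 1 else 0.
Proof.
unfold wtt_stage; rewrite andb_true_iff, Nat.leb_le.
destruct (run (W_stage i s) s (code p) x) as [[y u]|] eqn:E1;
  [destruct (run _ s (code q) x) as [[m v]|] eqn:E2|].
- cbn [fst snd]; rewrite andb_true_iff, Nat.leb_le, Nat.eqb_eq; split.
  + intros [? [? ?]]; split; [auto|exists y, u, m, v; auto].
  + intros [? [y' [u' [m' [v' [E3 [E4 [H1 H2]]]]]]]].
    injection E3 as -> ->; injection E4 as -> ->; auto.
- split; [intros []; discriminate|].
  intros [? [y' [u' [m' [v' [? [? ?]]]]]]]; discriminate.
- split; [intros []; discriminate|].
  intros [? [y' [u' [m' [v' [? [? ?]]]]]]]; discriminate.
Qed.

(** Since the use is bounded by [h x], agreement at cofinally many stages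
    already gives the true value: late stages see the oracle correctly below
    [h x]. This is what makes the condition on [x] only Pi_2. *)
Lemma wtt_le_W_iff e i :
  wtt_le (W e) (W i) <->
  exists p q, forall x t, exists s, wtt_stage e i p q x t s = true.
Proof.
split.
- intros [p [h [[q Hq] Hp]]]; exists (code p), (code q); intros x t.
  destruct (Hp x) as [y [u [Ey [Hy Hu]]]], (Hq x) as [v Ev].
  apply run_complete in Ey as [m1 Hm1].
  apply run_no_oracle_complete in Ev as [m2 Hm2].
  destruct (W_stage_agree i u) as [s1 Hs1], (W_stage_agree e (S x)) as [s2 Hs2].
  set (s := t + m1 + m2 + s1 + s2); exists s; apply wtt_stage_spec.
  split; [lia|exists y, u, (h x), v].
  rewrite Hm1, Hm2 by (try apply Hs1; lia); repeat split; auto.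
  assert (He := Hs2 s ltac:(lia) x (Nat.lt_succ_diag_r x)).
  destruct (W_stage e s x), Hy as [[Hx ->]|[Hx ->]]; auto.
  + now destruct Hx; apply He.
  + now apply He in Hx.
- intros [p [q H]].
  destruct (code_surj p) as [p' <-], (code_surj q) as [q' <-].
  (* Every successful stage contains a halting run of [q'], whose value is the bound at [x]. *)
  assert (Hh : forall x, {m | exists v, eval no_oracle q' x m v}).
  { intros x; apply constructive_indefinite_description.
    destruct (H x 0) as [s Hs].
    apply wtt_stage_spec in Hs as [_ [y [u [m [v [_ [Em _]]]]]]].
    exists m, v; now apply run_no_oracle_sound in Em. }
  exists p', (fun x => proj1_sig (Hh x)); split.
  { exists q'; intros x; apply (proj2_sig (Hh x)). }
  intros x; destruct (Hh x) as [m [v Em]]; cbn [proj1_sig].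
  destruct (W_stage_agree i m) as [s1 Hs1], (W_stage_agree e (S x)) as [s2 Hs2].
  (* A successful stage is requested after both approximations have settled. *)
  destruct (H x (s1 + s2)) as [s Hs].
  apply wtt_stage_spec in Hs as [Hst [y [u [m' [v' [Ey [Em' [Hu Hy]]]]]]]].
  apply run_no_oracle_sound in Em'.
  destruct (eval_det _ _ _ _ _ Em _ _ Em') as [<- <-].
  exists y, u; split; [|split; [|assumption]].
  + apply run_sound in Ey; apply (eval_local _ _ _ _ _ _ Ey).
    intros z Hz; apply (Hs1 s); lia.
  + assert (He := Hs2 s ltac:(lia) x (Nat.lt_succ_diag_r x)).
    rewrite Hy; destruct (W_stage e s x).
    * left; split; [now apply He|reflexivity].
    * right; split; [intros Hx; now apply He in Hx|reflexivity].
Qed.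

Lemma rec_W_stage {A} `{Enc A} (e s x : A -> nat) :
  recursive e -> recursive s -> recursive x ->
  recursive (fun a => W_stage (e a) (s a) (x a)).
Proof.
intros He Hs Hx; unfold W_stage; rec_auto.
apply (rec_run (fun _ _ => false)); rec_auto.
Qed.

Lemma rec_wtt_stage :
  recursive (fun z : nat * nat * (nat * nat) * (nat * nat) * nat =>
    let '(e, i, (p, q), (x, t), s) := z in wtt_stage e i p q x t s).
Proof.
apply (rec_ext (fun z => wtt_stage
  (fst (fst (fst (fst z)))) (snd (fst (fst (fst z))))
  (fst (snd (fst (fst z)))) (snd (snd (fst (fst z))))
  (fst (snd (fst z))) (snd (snd (fst z))) (snd z))).
{ now intros [[[[e i] [p q]] [x t]] s]. }
unfold wtt_stage; rec_auto.
all: try (apply rec_W_stage; rec_auto).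
all: try (apply (rec_run (fun _ _ => false)); rec_auto).
apply (rec_run (fun z => W_stage (snd (fst (fst (fst z)))) (snd z))); rec_auto.
apply rec_W_stage; rec_auto.
Qed.

(** The argument is read as [⟨⟨e, i⟩, ⟨⟨p, q⟩, ⟨⟨x, t⟩, s⟩⟩⟩]. *)
Definition sigma3_matrix (n : nat) : bool :=
  wtt_stage (pi1 (pi1 n)) (pi2 (pi1 n))
    (pi1 (pi1 (pi2 n))) (pi2 (pi1 (pi2 n)))
    (pi1 (pi1 (pi2 (pi2 n)))) (pi2 (pi1 (pi2 (pi2 n)))) (pi2 (pi2 (pi2 n))).

Lemma sigma3_wtt_le : sigma3_set (pair_set (fun e i => wtt_le (W e) (W i))).
Proof.
exists (fun n => sigma3_matrix n = true); split.
- exists (fun n => if sigma3_matrix n then 1 else 0); split.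
  + apply computable_iff; apply rec_if; [|rec_auto..].
    unfold sigma3_matrix.
    apply (rec_comp _ (fun n => (pi1 (pi1 n), pi2 (pi1 n), (pi1 (pi1 (pi2 n)),
      pi2 (pi1 (pi2 n))), (pi1 (pi1 (pi2 (pi2 n))), pi2 (pi1 (pi2 (pi2 n)))),
      pi2 (pi2 (pi2 n)))) rec_wtt_stage).
    rec_auto.
  + intros n; unfold char_val; destruct (sigma3_matrix n); auto.
- intros n; unfold sigma3_matrix.
  transitivity (wtt_le (W (pi1 n)) (W (pi2 n))).
  { split.
    - intros [e [i [-> H]]]; now rewrite pi1_pair, pi2_pair.
    - intros H; exists (pi1 n), (pi2 n); now rewrite pair_pi. }
  rewrite wtt_le_W_iff; split.
  + intros [p [q H]]; exists ⟨p, q⟩; intros b.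
    destruct (H (pi1 b) (pi2 b)) as [s Hs]; exists s.
    now rewrite ?pi1_pair, ?pi2_pair, ?pi1_pair, ?pi2_pair, ?pi1_pair, ?pi2_pair.
  + intros [a H]; exists (pi1 a), (pi2 a); intros x t.
    destruct (H ⟨x, t⟩) as [s Hs]; exists s.
    now rewrite ?pi1_pair, ?pi2_pair, ?pi1_pair, ?pi2_pair, ?pi1_pair, ?pi2_pair in Hs.
Qed.

(** * Nodes of the priority tree *)

(** What remains after the common prefix determines all relations between two nodes, so only this
    recursion has to be shown computable by hand. *)
Fixpoint strip (s t : list bool) : list bool * list bool :=
  match s, t with
  | a :: s', b :: t' => if Bool.eqb a b then strip s' t' else (s, t)
  | _, _ => (s, t)
  end.

Definition node_eqb (s t : list bool) : bool :=
  match fst (strip s t) with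
  | [] => match snd (strip s t) with [] => true | _ :: _ => false end
  | _ :: _ => false
  end.

Definition prefixb (s t : list bool) : bool :=
  match fst (strip s t) with [] => true | _ :: _ => false end.

(** [true] lies to the left of [false]. *)
Definition left_of (s t : list bool) : bool :=
  match fst (strip s t) with
  | [] => false
  | a :: _ => match snd (strip s t) with [] => false | _ :: _ => a end
  end.

(** [s] has higher priority than [t]: it is a proper prefix or to the left. *)
Definition higher (s t : list bool) : bool :=
  match snd (strip s t) with
  | [] => false
  | _ :: _ => match fst (strip s t) with [] => true | a :: _ => a end
  end.

Lemma strip_spec s t :
  exists c, s = c ++ fst (strip s t) /\ t = c ++ snd (strip s t) /\
    match fst (strip s t), snd (strip s t) with
    | a :: _, b :: _ => a = negb b
    | _, _ => True
    end.
Proof.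
revert t; induction s as [|a s IH]; intros [|b t]; cbn; try (exists []; now auto).
destruct (Bool.eqb_spec a b) as [->|Hab].
- destruct (IH t) as [c [H1 [H2 H3]]].
  exists (b :: c); cbn; now rewrite <- H1, <- H2.
- exists []; cbn; repeat split; now destruct a, b.
Qed.

Lemma strip_swap s t : strip t s = (snd (strip s t), fst (strip s t)).
Proof.
revert t; induction s as [|a s IH]; intros [|b t]; cbn; try reflexivity.
destruct a, b; cbn; auto.
Qed.

Lemma strip_refl s : strip s s = ([], []).
Proof. induction s as [|b c IH]; cbn; [reflexivity|]. now rewrite Bool.eqb_reflx. Qed.

Lemma node_eqb_eq s t : node_eqb s t = true <-> s = t.
Proof.
unfold node_eqb; split; [|intros ->; now rewrite strip_refl].
destruct (strip_spec s t) as [c [Es [Et _]]].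
destruct (fst (strip s t)), (snd (strip s t)); try discriminate; congruence.
Qed.

Lemma left_of_irrefl s : left_of s s = false.
Proof. unfold left_of; now rewrite strip_refl. Qed.

Lemma higher_irrefl s : higher s s = false.
Proof. unfold higher; now rewrite strip_refl. Qed.

Lemma left_of_higher s t : left_of s t = true -> higher s t = true.
Proof.
unfold left_of, higher; destruct (fst (strip s t)), (snd (strip s t)); auto; discriminate.
Qed.

Lemma left_of_spec s t :
  left_of s t = true ->
  exists j, j < length t /\ nth j s false = true /\ nth j t false = false.
Proof.
unfold left_of; destruct (strip_spec s t) as [c [Es [Et H]]].
destruct (fst (strip s t)) as [|a s'], (snd (strip s t)) as [|b t']; try discriminate.
intros ->; destruct b; [discriminate|]; exists (length c).
rewrite Es, Et, length_app, !nth_middle; cbn; repeat split; lia.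
Qed.

Lemma higher_cases s t :
  higher s t = true ->
  left_of s t = true \/ exists k, k < length t /\ s = firstn k t.
Proof.
unfold higher, left_of; destruct (strip_spec s t) as [c [Es [Et H]]].
destruct (fst (strip s t)) as [|a s'], (snd (strip s t)) as [|b t']; auto; try discriminate.
intros _; right; exists (length c).
rewrite Et, length_app; cbn; split; [lia|].
rewrite app_nil_r in Es; rewrite firstn_app, Nat.sub_diag, firstn_all; cbn.
now rewrite app_nil_r.
Qed.

Lemma higher_total s t : higher s t = true \/ s = t \/ higher t s = true.
Proof.
unfold higher; rewrite (strip_swap s t).
destruct (strip_spec s t) as [c [Es [Et H]]].
destruct (fst (strip s t)) as [|a s'], (snd (strip s t)) as [|b t']; cbn; auto.
- right; left; congruence.
- destruct b; auto.
Qed.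

Lemma not_higher_cases s t :
  higher s t = false -> prefixb t s = true \/ left_of t s = true.
Proof.
unfold higher, prefixb, left_of; rewrite (strip_swap s t).
destruct (strip_spec s t) as [c [Es [Et H]]].
destruct (fst (strip s t)) as [|a s'], (snd (strip s t)) as [|b t']; cbn; intros Hh;
  auto; try discriminate.
destruct b; cbn in H; subst; auto; discriminate.
Qed.

Lemma prefixb_nth s t j :
  prefixb s t = true -> j < length s -> nth j t false = nth j s false.
Proof.
unfold prefixb; destruct (strip_spec s t) as [c [Es [Et _]]].
destruct (fst (strip s t)); [|discriminate]; intros _ Hj.
rewrite app_nil_r in Es; subst c; rewrite Et, app_nth1; auto.
Qed.

Lemma rec_strip : recursive (fun z => strip (fst z) (snd z)).
Proof.
apply (rec_ext (fun z => Nat.iter (enc (fst z)) (fun z =>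
  match fst z with
  | [] => z
  | a :: s => match snd z with
              | [] => z
              | b :: t => if Bool.eqb a b then (s, t) else z
              end
  end) z)).
- intros [s t]; cbn [fst snd]; pose proof (length_enc s) as Hn.
  assert (Hfix : forall n z (f : list bool * list bool -> _), f z = z -> Nat.iter n f z = z).
  { intros n z f Hz; induction n as [|n IH]; [reflexivity|].
    now rewrite Nat.iter_succ, IH. }
  revert t Hn; generalize (enc s); induction s as [|a s IH]; intros n t Hn.
  + apply Hfix; now destruct t.
  + destruct t as [|b t]; [now apply Hfix|].
    destruct n as [|n]; [cbn in Hn; lia|cbn in Hn].
    cbn [strip]; destruct (Bool.eqb a b) eqn:Eab.
    * rewrite Nat.iter_succ_r; cbn [fst snd]; rewrite Eab; apply IH; lia.
    * apply Hfix; cbn; now rewrite Eab.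
- rec_auto; exists (fun z => pi1 z); split; [apply nat_recursive_fst|].
  intros [s t]; apply pi1_pair.
Qed.
#[export] Hint Resolve rec_strip : recursive.

Lemma rec_node_eqb : recursive (fun z => node_eqb (fst z) (snd z)).
Proof. unfold node_eqb; rec_auto. Qed.

Lemma rec_prefixb : recursive (fun z => prefixb (fst z) (snd z)).
Proof. unfold prefixb; rec_auto. Qed.

Lemma rec_left_of : recursive (fun z => left_of (fst z) (snd z)).
Proof. unfold left_of; rec_auto. Qed.

Lemma rec_higher : recursive (fun z => higher (fst z) (snd z)).
Proof. unfold higher; rec_auto. Qed.

(** Decodes [k] as a list, pushing its entries on an accumulator, which reverses them. Every number
    is a node; one node has many numbers, as any nonzero entry counts as [true]. *)
Definition node_of (k : nat) : list bool :=
  snd (Nat.iter k (fun z =>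
    match fst z with
    | 0 => z
    | S m => (pi2 m, negb (pi1 m =? 0) :: snd z)
    end) (k, [])).

Lemma node_of_surj s : exists k, node_of k = s.
Proof.
exists (enc (rev s)); unfold node_of; rewrite <- (rev_involutive s) at 3.
rewrite <- (app_nil_r (rev (rev s))).
pose proof (length_enc (rev s)) as Hn; revert Hn.
generalize (@nil bool) as acc; generalize (enc (rev s)) at 1 2 as n.
induction (rev s) as [|b l IH]; intros n acc Hn.
- cbn [enc enc_list]; induction n as [|n IHn]; [reflexivity|].
  rewrite Nat.iter_succ_r; apply IHn; cbn; lia.
- destruct n as [|n]; [cbn in Hn; lia|].
  rewrite Nat.iter_succ_r.
  change (enc (b :: l)) with (S ⟨enc b, enc l⟩); cbn [fst snd].
  rewrite pi1_pair, pi2_pair, IH by (cbn in Hn; lia).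
  cbn [rev]; rewrite <- app_assoc; now destruct b.
Qed.

Lemma rec_node_of : recursive node_of.
Proof. unfold node_of; rec_auto. Qed.

Definition trues (s : list bool) : list nat :=
  snd (fold_left (fun z (b : bool) => (S (fst z), if b then fst z :: snd z else snd z))
    s (0, [])).

Lemma trues_spec s j : In j (trues s) <-> nth j s false = true.
Proof.
unfold trues.
enough (H : forall i acc, In j (snd (fold_left (fun z (b : bool) =>
    (S (fst z), if b then fst z :: snd z else snd z)) s (i, acc))) <->
  In j acc \/ i <= j /\ nth (j - i) s false = true).
{ rewrite H, Nat.sub_0_r; cbn; intuition lia. }
induction s as [|b s IH]; intros i acc; cbn [fold_left fst snd].
- destruct (j - i); cbn; intuition discriminate.
- rewrite IH; destruct (Nat.eq_dec i j) as [->|Hij].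
  + rewrite Nat.sub_diag; destruct b; cbn; intuition lia.
  + assert (E : S i <= j /\ nth (j - S i) s false = true <->
      i <= j /\ nth (j - i) (b :: s) false = true).
    { split; intros [H1 H2]; (split; [lia|]).
      - now replace (j - i) with (S (j - S i)) by lia.
      - now replace (j - i) with (S (j - S i)) in H2 by lia. }
    rewrite E; destruct b; cbn [In]; intuition lia.
Qed.

Lemma rec_trues : recursive trues.
Proof. unfold trues; rec_auto. Qed.
#[export] Hint Resolve rec_node_eqb rec_prefixb rec_left_of rec_higher rec_node_of
  rec_trues : recursive.

Definition memb (n : nat) (l : list nat) : bool := existsb (Nat.eqb n) l.

Lemma memb_In n l : memb n l = true <-> In n l.
Proof.
unfold memb; rewrite existsb_exists; split.
- intros [m [Hm E]]; apply Nat.eqb_eq in E; now subst.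
- intros H; exists n; now rewrite Nat.eqb_refl.
Qed.

Lemma rec_memb : recursive (fun z => memb (fst z) (snd z)).
Proof. unfold memb; rec_auto. Qed.
#[export] Hint Resolve rec_memb : recursive.

Lemma rec_length {A} `{Enc A} : recursive (fun l : list A => length l).
Proof.
apply (rec_ext (fun l => fold_left (fun n _ => S n) l 0)); [|rec_auto].
intros l; enough (E : forall n, fold_left (fun n _ => S n) l n = n + length l) by apply E.
induction l as [|a l IH]; intros n; cbn; [lia|]. rewrite IH; lia.
Qed.

(** An index [j = ⟨⟨x, y⟩, a⟩] stands for the edge from [x] to [y], suggested by
    the possible witness [a]. *)
Definition source (j : nat) : nat := pi1 (pi1 j).
Definition target (j : nat) : nat := pi2 (pi1 j).

(** * Reachability along guessed edges *)

Definition grow (es U : list nat) : list nat :=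
  match find (fun j => memb (source j) U && negb (memb (target j) U)) es with
  | Some j => target j :: U
  | None => U
  end.

Definition upset (es : list nat) (x : nat) : list nat :=
  Nat.iter (S (length es)) (grow es) [x].

Lemma grow_cases es U :
  grow es U = U /\
    (forall j, In j es -> In (source j) U -> In (target j) U) \/
  exists j, In j es /\ In (source j) U /\ ~ In (target j) U /\
    grow es U = target j :: U.
Proof.
unfold grow; destruct (find _ es) as [j|] eqn:E.
- right; apply find_some in E as [Hj E]; exists j.
  apply andb_true_iff in E as [E1 E2]; apply memb_In in E1.
  repeat split; auto; intros H; apply memb_In in H; now rewrite H in E2.
- left; split; [reflexivity|]; intros j Hj Hs.
  apply (find_none _ _ E) in Hj; apply memb_In in Hs; rewrite Hs in Hj.
  apply memb_In; now destruct (memb (target j) U).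
Qed.

Lemma upset_self es x : In x (upset es x).
Proof.
unfold upset; generalize (S (length es)) as n; induction n as [|n IH]; [now left|].
rewrite Nat.iter_succ.
destruct (grow_cases es (Nat.iter n (grow es) [x])) as [[-> _]|[j [_ [_ [_ ->]]]]];
  [|right]; exact IH.
Qed.

Lemma upset_sound es x (Q : relation nat) :
  preorder nat Q -> (forall j, In j es -> Q (source j) (target j)) ->
  forall z, In z (upset es x) -> Q x z.
Proof.
intros [Hr Ht] HQ; unfold upset; generalize (S (length es)) as n; induction n as [|n IH].
- intros z [<-|[]]; apply Hr.
- intros z; rewrite Nat.iter_succ.
  destruct (grow_cases es (Nat.iter n (grow es) [x])) as [[-> _]|[j [Hj [Hs [_ ->]]]]];
    [apply IH|].
  intros [<-|Hz]; [|now apply IH].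
  apply (Ht _ (source j)); auto.
Qed.

(** Every iteration that changes the set adds a new target, so the iteration
    has stabilized after [length es + 1] rounds. *)
Lemma upset_closed es x j :
  In j es -> In (source j) (upset es x) -> In (target j) (upset es x).
Proof.
assert (H : forall n, let U := Nat.iter n (grow es) [x] in
  (forall j, In j es -> In (source j) U -> In (target j) U) \/
  NoDup U /\ length U = S n /\ incl U (x :: map target es)).
{ induction n as [|n IH]; intros U.
  - right; repeat split; [repeat constructor; intros []|].
    intros z [<-|[]]; now left.
  - unfold U; rewrite Nat.iter_succ; clear U.
    set (U := Nat.iter n (grow es) [x]) in *.
    destruct (grow_cases es U) as [[-> HU]|[k [Hk [Hs [Ht ->]]]]]; [now left|].
    destruct IH as [IH|[H1 [H2 H3]]]; [now apply IH in Hs|].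
    right; repeat split; [now constructor|cbn; congruence|].
    intros z [<-|Hz]; [right; now apply in_map|auto]. }
destruct (H (S (length es))) as [H1|[H1 [H2 H3]]]; [apply H1|].
apply (NoDup_incl_length H1) in H3; cbn [length] in H3.
rewrite length_map in H3; lia.
Qed.

Lemma rec_source : recursive source.
Proof. unfold source; rec_auto. Qed.

Lemma rec_target : recursive target.
Proof. unfold target; rec_auto. Qed.
#[export] Hint Resolve rec_length rec_source rec_target : recursive.

Lemma rec_grow : recursive (fun z => grow (fst z) (snd z)).
Proof. unfold grow; rec_auto. Qed.
#[export] Hint Resolve rec_grow : recursive.

Lemma rec_upset : recursive (fun z => upset (fst z) (snd z)).
Proof. unfold upset; rec_auto. Qed.
#[export] Hint Resolve rec_upset : recursive.

(** * Eventual properties *)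

Definition eventually (P : nat -> Prop) : Prop :=
  exists m, forall n, m <= n -> P n.

Lemma eventually_and P P' :
  eventually P -> eventually P' -> eventually (fun n => P n /\ P' n).
Proof.
intros [m H] [m' H']; exists (Nat.max m m'); intros n Hn.
split; [apply H|apply H']; lia.
Qed.

Lemma eventually_impl (P P' : nat -> Prop) :
  (forall n, P n -> P' n) -> eventually P -> eventually P'.
Proof. intros H [m Hm]; exists m; auto. Qed.

Lemma eventually_Forall {A} (P : A -> nat -> Prop) l :
  (forall a, In a l -> eventually (P a)) ->
  eventually (fun n => forall a, In a l -> P a n).
Proof.
induction l as [|a l IH]; intros H; [exists 0; intros n _ a []|].
eapply eventually_impl; [|apply eventually_and; [apply (H a); now left|
  apply IH; intros b Hb; apply H; now right]].
intros n [H1 H2] b [<-|Hb]; auto.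
Qed.

Lemma least_true (P : nat -> bool) n :
  P n = true -> exists m, P m = true /\ forall k, k < m -> P k = false.
Proof.
induction n as [n IH] using lt_wf_ind; intros Hn.
destruct (existsb P (seq 0 n)) eqn:E.
- apply existsb_exists in E as [k [Hk E]]; apply in_seq in Hk.
  apply (IH k); [lia|assumption].
- exists n; split; [assumption|intros k Hk].
  destruct (P k) eqn:Ek; [|reflexivity].
  rewrite <- E; symmetry; apply existsb_exists; exists k; split; [|assumption].
  apply in_seq; lia.
Qed.

(** * Visits and the guessing of infinite indices *)

Section Visits.
Context (r : nat -> nat -> nat -> bool).
Context (rec_r : recursive (fun z => r (fst (fst z)) (snd (fst z)) (snd z))).

Definition infinite_index (j : nat) : Prop := forall b, exists c, r j b c = true.

Definition true_node (s : list bool) : Prop :=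
  forall j, j < length s -> (nth j s false = true <-> infinite_index j).

Definition check (s : list bool) (b c : nat) : bool :=
  forallb (fun j =>
    forallb (fun b' => existsb (fun c' => r j b' c') (seq 0 c)) (seq 0 (S b)))
  (trues s).

Definition stage_node (s : nat) : list bool := node_of (pi1 s).

(** At stage [⟨k, ⟨b, c⟩⟩] the node with number [k] is visited if [c] is the
    first moment at which its positive guesses are confirmed up to [b]. Because
    of [k <= b], a wrong positive guess is made at finitely many visits
    altogether, even if all the nodes that contain it are counted. *)
Definition visit (s : nat) : bool :=
  (pi1 s <=? pi1 (pi2 s)) && check (stage_node s) (pi1 (pi2 s)) (pi2 (pi2 s)) &&
  match pi2 (pi2 s) with
  | 0 => true
  | S c => negb (check (stage_node s) (pi1 (pi2 s)) c)
  end.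

Lemma check_spec s b c :
  check s b c = true <->
  forall j, nth j s false = true -> forall b', b' <= b -> exists c', c' < c /\ r j b' c' = true.
Proof.
unfold check; rewrite forallb_forall; split.
- intros H j Hj b' Hb; apply trues_spec, H in Hj.
  rewrite forallb_forall in Hj.
  specialize (Hj b'); rewrite in_seq in Hj; specialize (Hj ltac:(lia)).
  apply existsb_exists in Hj as [c' [Hc' E]]; apply in_seq in Hc'.
  exists c'; split; [lia|assumption].
- intros H j Hj; apply trues_spec in Hj; apply forallb_forall; intros b' Hb.
  apply in_seq in Hb; destruct (H j Hj b' ltac:(lia)) as [c' [Hc E]].
  apply existsb_exists; exists c'; split; [apply in_seq; lia|assumption].
Qed.

Lemma check_mono s b c d : c <= d -> check s b c = true -> check s b d = true.
Proof.
rewrite !check_spec; intros Hcd H j Hj b' Hb.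
destruct (H j Hj b' Hb) as [c' [Hc E]]; exists c'; split; [lia|assumption].
Qed.

Lemma visit_true_node s t :
  true_node s -> exists n, t <= n /\ visit n = true /\ stage_node n = s.
Proof.
intros Hs; destruct (node_of_surj s) as [k Hk].
(* [k <= b] is demanded by [visit], and [t <= b] forces the stage [⟨k, ⟨b, c⟩⟩] to be at least
   [t]. *)
set (b := Nat.max k t).
assert (Hc : eventually (fun c => check s b c = true)).
{ eapply eventually_impl; [intros c H; apply check_spec; intros j Hj b' Hb';
    exact (H j (proj2 (trues_spec s j) Hj) b' (proj2 (in_seq (S b) 0 b') ltac:(lia)))|].
  apply (eventually_Forall (fun j n => forall b', In b' (seq 0 (S b)) ->
    exists c', c' < n /\ r j b' c' = true)); intros j Hj.
  apply (eventually_Forall (fun b' n => exists c', c' < n /\ r j b' c' = true));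
    intros b' _.
  apply trues_spec in Hj.
  assert (Hlen : j < length s).
  { destruct (Nat.lt_ge_cases j (length s)); [assumption|].
    rewrite nth_overflow in Hj; [discriminate|assumption]. }
  apply (Hs j Hlen) in Hj; destruct (Hj b') as [c Hc].
  exists (S c); intros n Hn; exists c; split; [lia|assumption]. }
destruct Hc as [c0 Hc0].
destruct (least_true (check s b) c0 (Hc0 c0 (le_n _))) as [c [Hc Hleast]].
exists ⟨k, ⟨b, c⟩⟩; unfold visit, stage_node; rewrite !pi1_pair, ?pi2_pair, ?pi1_pair, ?pi2_pair.
rewrite Hk, Hc; repeat split.
- pose proof (pair_ge k ⟨b, c⟩); pose proof (pair_ge b c); lia.
- rewrite andb_true_r; apply andb_true_iff; split; [apply Nat.leb_le; lia|].
  destruct c as [|c]; [reflexivity|]; now rewrite Hleast by lia.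
Qed.

(** Since [check] is monotone in [c], a node number and a bound [b] admit only one first moment
    [c]. *)
Lemma visit_unique s t :
  visit s = true -> visit t = true -> pi1 s = pi1 t -> pi1 (pi2 s) = pi1 (pi2 t) -> s = t.
Proof.
unfold visit, stage_node; rewrite !andb_true_iff; intros [[_ Hs] Hs'] [[_ Ht] Ht'] E1 E2.
assert (Heta : forall n, ⟨pi1 n, ⟨pi1 (pi2 n), pi2 (pi2 n)⟩⟩ = n)
  by (intros n; now rewrite !pair_pi).
enough (E3 : pi2 (pi2 s) = pi2 (pi2 t)).
{ rewrite <- (Heta s), E1, E2, E3; apply Heta. }
rewrite E1, E2 in Hs, Hs'.
destruct (Nat.lt_trichotomy (pi2 (pi2 s)) (pi2 (pi2 t))) as [H|[H|H]]; [|assumption|].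
- destruct (pi2 (pi2 t)) as [|c]; [lia|].
  now rewrite (check_mono _ _ (pi2 (pi2 s)) c) in Ht' by (assumption || lia).
- destruct (pi2 (pi2 s)) as [|c]; [lia|].
  now rewrite (check_mono _ _ (pi2 (pi2 t)) c) in Hs' by (assumption || lia).
Qed.

(** If confirmation fails at [b0], a visit that guesses [j] positively has [b < b0], hence [k < b0]
    too; each of these finitely many pairs allows at most one visit. *)
Lemma visit_false_guess j :
  ~ infinite_index j ->
  eventually (fun s => visit s = true -> nth j (stage_node s) false = false).
Proof.
intros Hj; apply not_all_ex_not in Hj as [b0 Hb0].
assert (H : eventually (fun s => forall k, In k (seq 0 b0) -> forall b, In b (seq 0 b0) ->
  visit s = true -> ~ (pi1 s = k /\ pi1 (pi2 s) = b))).
{ apply (eventually_Forall (fun k s => forall b, In b (seq 0 b0) ->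
    visit s = true -> ~ (pi1 s = k /\ pi1 (pi2 s) = b))); intros k _.
  apply (eventually_Forall (fun b s => visit s = true -> ~ (pi1 s = k /\ pi1 (pi2 s) = b)));
    intros b _.
  destruct (classic (exists t, visit t = true /\ pi1 t = k /\ pi1 (pi2 t) = b))
    as [[t [Ht [Hk Hb]]]|Hnone].
  - exists (S t); intros s Hs Hv [E1 E2].
    assert (s = t) by (apply visit_unique; congruence); lia.
  - exists 0; intros s _ Hv E; apply Hnone; exists s; auto. }
revert H; apply eventually_impl; intros s H Hv.
destruct (nth j (stage_node s) false) eqn:E; [exfalso|reflexivity].
assert (Hv' := Hv); unfold visit in Hv'; rewrite !andb_true_iff, Nat.leb_le in Hv'.
destruct Hv' as [[Hle Hc] _]; rewrite check_spec in Hc.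
assert (Hb : pi1 (pi2 s) < b0).
{ apply Nat.nle_gt; intros Hb; destruct (Hc j E b0 Hb) as [c [_ Hr]].
  apply Hb0; eauto. }
apply (H (pi1 s)) with (b := pi1 (pi2 s)); auto; apply in_seq; lia.
Qed.

(** A node to the left guesses [true] where [s] guesses [false]. A true node has finitely many such
    positions, and each yields a wrong positive guess, made at finitely many visits. *)
Lemma visit_left s :
  true_node s -> eventually (fun t => visit t = true -> left_of (stage_node t) s = false).
Proof.
intros Hs.
assert (H : eventually (fun t => forall j, In j (seq 0 (length s)) ->
  nth j s false = false -> visit t = true -> nth j (stage_node t) false = false)).
{ apply (eventually_Forall (fun j t => nth j s false = false -> visit t = true ->
    nth j (stage_node t) false = false)); intros j Hj; apply in_seq in Hj.
  destruct (nth j s false) eqn:E; [exists 0; discriminate|].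
  eapply eventually_impl; [intros t H _; exact H|].
  apply visit_false_guess; intros Hi; apply Hs in Hi; [congruence|lia]. }
revert H; apply eventually_impl; intros t H Hv.
destruct (left_of (stage_node t) s) eqn:E; [exfalso|reflexivity].
apply left_of_spec in E as [j [Hj [E1 E2]]].
rewrite (H j) in E1; auto; [discriminate|apply in_seq; lia].
Qed.

Lemma true_node_exists n : exists s, length s = n /\ true_node s.
Proof.
induction n as [|n [s [Hn Hs]]]; [exists []; split; [reflexivity|intros j Hj; cbn in Hj; lia]|].
assert (Hb : exists b : bool, b = true <-> infinite_index n).
{ destruct (classic (infinite_index n)); [exists true|exists false]; intuition discriminate. }
destruct Hb as [b Hb]; exists (s ++ [b]); split; [rewrite length_app; cbn; lia|].
intros j Hj; rewrite length_app in Hj; cbn in Hj.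
destruct (Nat.eq_dec j (length s)) as [->|Hne].
- now rewrite nth_middle, Hn.
- rewrite app_nth1 by lia; apply Hs; lia.
Qed.

Lemma true_node_firstn k s : true_node s -> true_node (firstn k s).
Proof.
intros Hs j Hj; rewrite length_firstn in Hj.
rewrite nth_firstn; replace (j <? k) with true by (symmetry; apply Nat.ltb_lt; lia).
apply Hs; lia.
Qed.

Lemma rec_check {A} `{Enc A} (s : A -> list bool) (b c : A -> nat) :
  recursive s -> recursive b -> recursive c ->
  recursive (fun a => check (s a) (b a) (c a)).
Proof. intros Hs Hb Hc; unfold check; rec_auto. Qed.

Lemma rec_stage_node : recursive stage_node.
Proof. unfold stage_node; rec_auto. Qed.

Lemma rec_visit : recursive visit.
Proof.
pose proof rec_stage_node; unfold visit; rec_auto.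
all: apply rec_check; rec_auto.
Qed.

End Visits.

(** * The construction *)

Section Construction.
Context (r : nat -> nat -> nat -> bool).
Context (rec_r : recursive (fun z => r (fst (fst z)) (snd (fst z)) (snd z))).

(** The length [⟨⟨x, y⟩, p⟩] of a node is its requirement: the program number [p]
    does not compute the [x]-th set from the [y]-th one. *)
Definition req_x (s : list bool) : nat := pi1 (pi1 (length s)).
Definition req_y (s : list bool) : nat := pi2 (pi1 (length s)).
Definition req_p (s : list bool) : nat := pi2 (length s).

(** The indices of the sets into which the witnesses of [s] may be put. *)
Definition hosts (s : list bool) : list nat := upset (trues s) (req_x s).

(** Each number [w] can only be a witness of the node of stage [w]. *)
Definition in_set (E : list nat) (z w : nat) : bool :=
  memb w E && memb z (hosts (stage_node w)).

Definition drop_right (s : list bool) (L : list nat) : list nat :=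
  filter (fun w => negb (left_of s (stage_node w))) L.
Definition drop_lower (s : list bool) (L : list nat) : list nat :=
  filter (fun w => negb (higher s (stage_node w))) L.

(** The state [(L, E)] consists of the current witnesses and of the witnesses
    that have been enumerated. *)
Definition stage_step (n : nat) (LE : list nat * list nat) : list nat * list nat :=
  let s := stage_node n in
  let L := fst LE in
  let E := snd LE in
  if visit r n then
    if memb (req_y s) (hosts s) then (drop_right s L, E)
    else
      match find (fun w => node_eqb s (stage_node w)) L with
      | None => (n :: drop_lower s L, E)
      | Some w =>
          if memb w E then (drop_right s L, E)
          else
            match run (in_set E (req_y s)) n (req_p s) w with
            | None => (drop_right s L, E)
            | Some yu =>
                if (fst yu =? 0) && (snd yu <=? n)
                then (drop_lower s L, w :: E)
                else (drop_right s L, E)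
            end
      end
  else LE.

Definition state_at (n : nat) : list nat * list nat :=
  snd (Nat.iter n (fun z => (S (fst z), stage_step (fst z) (snd z))) (0, ([], []))).

Lemma state_at_S n : state_at (S n) = stage_step n (state_at n).
Proof.
unfold state_at; rewrite Nat.iter_succ; cbn [snd]; f_equal.
induction n as [|n IH]; [reflexivity|]. rewrite Nat.iter_succ; cbn [fst]; congruence.
Qed.

Definition live (n : nat) : list nat := fst (state_at n).
Definition enumerated (n : nat) : list nat := snd (state_at n).

Definition member (z w : nat) : Prop := exists n, in_set (enumerated n) z w = true.

Definition active (s : list bool) : Prop := ~ In (req_y s) (hosts s).

(** The form of [stage_step] used for case analysis. The premise of [tr_visit] records why an active
    node does not act: its witness is already enumerated, or no value 0 with use at most [n] is seen
    yet. *)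
Inductive transition (n : nat) (L E : list nat) : list nat -> list nat -> Prop :=
| tr_skip : visit r n = false -> transition n L E L E
| tr_visit :
    visit r n = true ->
    (active (stage_node n) -> exists w, In w L /\ stage_node w = stage_node n /\
      (In w E \/ forall u, u <= n ->
        run (in_set E (req_y (stage_node n))) n (req_p (stage_node n)) w <> Some (0, u))) ->
    transition n L E (drop_right (stage_node n) L) E
| tr_appoint :
    visit r n = true -> active (stage_node n) ->
    (forall w, In w L -> stage_node w <> stage_node n) ->
    transition n L E (n :: drop_lower (stage_node n) L) E
| tr_enumerate w u :
    visit r n = true -> active (stage_node n) ->
    In w L -> stage_node w = stage_node n -> ~ In w E ->
    run (in_set E (req_y (stage_node n))) n (req_p (stage_node n)) w = Some (0, u) ->
    u <= n ->
    transition n L E (drop_lower (stage_node n) L) (w :: E).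

Lemma stage_transition n :
  transition n (live n) (enumerated n) (live (S n)) (enumerated (S n)).
Proof.
unfold live, enumerated; rewrite state_at_S.
destruct (state_at n) as [L E]; unfold stage_step; cbn [fst snd].
destruct (visit r n) eqn:Hv; [|now constructor].
destruct (memb (req_y (stage_node n)) (hosts (stage_node n))) eqn:Ha.
{ apply memb_In in Ha; constructor; [assumption|contradiction]. }
assert (Hact : active (stage_node n)).
{ intros H; apply memb_In in H; congruence. }
destruct (find _ L) as [w|] eqn:Ef.
- apply find_some in Ef as [Hw Ef]; apply node_eqb_eq in Ef; symmetry in Ef.
  destruct (memb w E) eqn:HE.
  { apply memb_In in HE; constructor; [assumption|]; intros _; exists w; auto. }
  destruct (run _ n _ w) as [[y u]|] eqn:Er; cbn [fst snd].
  + destruct (y =? 0) eqn:Hy, (u <=? n) eqn:Hu; cbn [andb fst snd];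
      rewrite ?Nat.eqb_eq, ?Nat.eqb_neq, ?Nat.leb_le, ?Nat.leb_gt in *; subst.
    1: apply (tr_enumerate n L E w u); auto; intros H; apply memb_In in H; congruence.
    all: constructor; [assumption|]; intros _; exists w; repeat split; auto; right;
      rewrite Er; intros v Hv' [=]; subst; lia || congruence.
  + constructor; [assumption|]; intros _; exists w; repeat split; auto.
    right; rewrite Er; discriminate.
- apply tr_appoint; auto; intros w Hw Hs.
  apply (find_none _ _ Ef) in Hw; cbn in Hw.
  rewrite Hs in Hw; now rewrite (proj2 (node_eqb_eq _ _) eq_refl) in Hw.
Qed.

(** The stages that cancel all witnesses of lower priority: they appoint a witness, which can only
    be [n], or enumerate one. Other visits cancel only to the right. *)
Definition acts (n : nat) : Prop :=
  In n (live (S n)) \/ exists w, In w (enumerated (S n)) /\ ~ In w (enumerated n).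

Lemma in_drop_right s w L :
  In w (drop_right s L) <-> In w L /\ left_of s (stage_node w) = false.
Proof. unfold drop_right; now rewrite filter_In, negb_true_iff. Qed.

Lemma in_drop_lower s w L :
  In w (drop_lower s L) <-> In w L /\ higher s (stage_node w) = false.
Proof. unfold drop_lower; now rewrite filter_In, negb_true_iff. Qed.

Lemma live_S_cases n w :
  In w (live (S n)) -> In w (live n) \/ w = n.
Proof.
destruct (stage_transition n); cbn [In]; rewrite ?in_drop_right, ?in_drop_lower;
  intuition.
Qed.

Lemma live_lt n w : In w (live n) -> w < n.
Proof.
induction n as [|n IH]; [intros []|].
intros H; apply live_S_cases in H as [H| ->]; [apply IH in H|]; lia.
Qed.

Lemma enumerated_S_cases n w :
  In w (enumerated (S n)) -> In w (enumerated n) \/ In w (live n).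
Proof.
destruct (stage_transition n); cbn [In]; intuition congruence.
Qed.

Lemma enumerated_mono m n w :
  m <= n -> In w (enumerated m) -> In w (enumerated n).
Proof.
induction 1 as [|n _ IH]; [auto|]; intros H; apply IH in H.
destruct (stage_transition n); [..|right]; auto.
Qed.

(** Stage [n] can appoint only the number [n], so a cancelled number never returns. *)
Lemma live_before m n w :
  w < m -> m <= n -> In w (live n) -> In w (live m).
Proof.
intros Hw Hmn; induction Hmn as [|n Hmn IH]; [auto|].
intros H; apply live_S_cases in H as [H| ->]; [auto|lia].
Qed.

Lemma enumerated_before m n w :
  w < m -> m <= n -> In w (enumerated n) -> In w (enumerated m) \/ In w (live m).
Proof.
intros Hw Hmn; induction Hmn as [|n Hmn IH]; [auto|].
intros H; apply enumerated_S_cases in H as [H|H]; [auto|].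
right; now apply (live_before m n).
Qed.

Lemma enumerated_lt n w : In w (enumerated n) -> w < n.
Proof.
induction n as [|n IH]; [intros []|].
intros H; apply enumerated_S_cases in H as [H|H]; [apply IH in H|apply live_lt in H]; lia.
Qed.

(** Consequently stage [w] is one at which a node acts, so restrictions on acting nodes apply to
    enumerated numbers. *)
Lemma enumerated_appointed n w : In w (enumerated n) -> In w (live (S w)).
Proof.
intros H; assert (Hw := enumerated_lt _ _ H).
destruct (enumerated_before (S w) n w ltac:(lia) Hw H) as [H'|H']; [|assumption].
apply enumerated_S_cases in H' as [H'|H']; [apply enumerated_lt in H'|apply live_lt in H']; lia.
Qed.

Lemma live_unique n w w' :
  In w (live n) -> In w' (live n) -> stage_node w = stage_node w' -> w = w'.
Proof.
revert w w'; induction n as [|n IH]; [intros w w' []|]; intros w w'.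
destruct (stage_transition n) as [| |Hv Ha Hnone|];
  rewrite ?in_drop_right, ?in_drop_lower; auto.
- intros [Hw _] [Hw' _]; auto.
- intros [<-|Hw] [<-|Hw'] E; auto; rewrite in_drop_lower in *.
  + now destruct (Hnone w').
  + now destruct (Hnone w).
  + now apply IH.
- intros [Hw _] [Hw' _]; auto.
Qed.

Lemma acts_visit n : acts n -> visit r n = true.
Proof.
unfold acts; destruct (stage_transition n) as [| | |]; auto.
intros [H'|[w [H1 H2]]]; [apply live_lt in H'; lia|contradiction].
Qed.

Lemma live_keep n w :
  In w (live n) ->
  (visit r n = true -> left_of (stage_node n) (stage_node w) = false) ->
  (acts n -> higher (stage_node n) (stage_node w) = false) ->
  In w (live (S n)).
Proof.
unfold acts; destruct (stage_transition n) as [| | |w' u]; auto; intros Hw Hl Ha.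
- apply in_drop_right; auto.
- right; apply in_drop_lower; split; [assumption|apply Ha; now left; left].
- apply in_drop_lower; split; [assumption|apply Ha; right].
  exists w'; split; [now left|assumption].
Qed.

(** * Finite injury along the true path *)

(** Excludes the two ways in which a witness of [s] can be cancelled at stage [n]. *)
Definition safe (s : list bool) (n : nat) : Prop :=
  (visit r n = true -> left_of (stage_node n) s = false) /\
  (acts n -> higher (stage_node n) s = false).

Lemma live_forever s m n w :
  (forall k, m <= k -> safe s k) -> m <= n -> In w (live m) -> stage_node w = s ->
  In w (live n).
Proof.
intros Hs Hmn Hw E; induction Hmn as [|n Hmn IH]; [assumption|].
destruct (Hs n Hmn); apply live_keep; auto; now rewrite E.
Qed.

Lemma acts_live n :
  acts n -> exists w, In w (live (S n)) /\ stage_node w = stage_node n.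
Proof.
unfold acts; destruct (stage_transition n) as [| | |w u Hv Ha Hw E]; intros H'.
- destruct H' as [H'|[w [H1 H2]]]; [apply live_lt in H'; lia|contradiction].
- destruct H' as [H'|[w [H1 H2]]]; [|contradiction].
  apply in_drop_right in H' as [H' _]; apply live_lt in H'; lia.
- exists n; split; [now left|reflexivity].
- exists w; split; [|assumption].
  apply in_drop_lower; split; [assumption|rewrite E; apply higher_irrefl].
Qed.

Lemma acts_with_live n w :
  acts n -> In w (live n) -> stage_node w = stage_node n ->
  ~ In w (enumerated n) /\ In w (enumerated (S n)).
Proof.
intros Ha Hw E; revert Ha; unfold acts.
destruct (stage_transition n) as [| |Hv Ha Hnone|w' u Hv Ha Hw' E' HE]; intros H'.
- destruct H' as [H'|[w' [H1 H2]]]; [apply live_lt in H'; lia|contradiction].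
- destruct H' as [H'|[w' [H1 H2]]]; [|contradiction].
  apply in_drop_right in H' as [H' _]; apply live_lt in H'; lia.
- now destruct (Hnone w).
- assert (w' = w) as -> by (apply (live_unique n); congruence).
  split; [assumption|now left].
Qed.

(** A node that is no longer injured appoints at most one more witness and
    enumerates it at most once. *)
Lemma safe_acts_finitely s :
  eventually (safe s) -> eventually (fun n => acts n -> stage_node n <> s).
Proof.
intros [m Hm]; apply NNPP; intros Hinf.
assert (H : forall k, exists n, k <= n /\ acts n /\ stage_node n = s).
{ intros k; apply NNPP; intros H; apply Hinf; exists k; intros n Hn Ha E.
  apply H; eauto. }
destruct (H m) as [n1 [Hn1 [Ha1 E1]]].
apply acts_live in Ha1 as [w [Hw E]]; rewrite E1 in E.
destruct (H (S n1)) as [n2 [Hn2 [Ha2 E2]]].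
assert (Hw2 : In w (live n2)) by (apply (live_forever s (S n1)); auto; intros; apply Hm; lia).
apply (acts_with_live n2 w) in Ha2 as [_ Hw2']; [|assumption|congruence].
destruct (H (S n2)) as [n3 [Hn3 [Ha3 E3]]].
assert (Hw3 : In w (live n3)).
{ apply (live_forever s (S n1)); auto; [intros; apply Hm|]; lia. }
apply (acts_with_live n3 w) in Ha3 as [Hw3' _]; [|assumption|congruence].
apply Hw3', (enumerated_mono (S n2)); [lia|assumption].
Qed.

(** Induction on the length: a node of higher priority is a proper prefix, hence a true node that
    acts finitely often by induction, or it lies to the left and is eventually never visited. *)
Lemma true_node_safe s : true_node r s -> eventually (safe s).
Proof.
remember (length s) as l eqn:Hl; revert s Hl.
induction l as [l IH] using lt_wf_ind; intros s Hl Hs.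
assert (Hpre : eventually (fun n => forall k, In k (seq 0 l) ->
  acts n -> stage_node n <> firstn k s)).
{ apply (eventually_Forall (fun k n => acts n -> stage_node n <> firstn k s)).
  intros k Hk; apply in_seq in Hk; apply safe_acts_finitely.
  apply (IH k); [lia|rewrite length_firstn; lia|now apply true_node_firstn]. }
pose proof (eventually_and _ _ Hpre (visit_left r s Hs)) as H.
revert H; apply eventually_impl; intros n [Hp Hv]; split; [assumption|].
intros Ha; destruct (higher (stage_node n) s) eqn:E; [exfalso|reflexivity].
apply higher_cases in E as [E|[k [Hk E]]].
- rewrite Hv in E; [discriminate|now apply acts_visit].
- apply (Hp k); auto; apply in_seq; lia.
Qed.

(** * Preservation of computations and diagonalization *)

Lemma in_set_In E z w :
  in_set E z w = true <-> In w E /\ In z (hosts (stage_node w)).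
Proof. unfold in_set; now rewrite andb_true_iff, !memb_In. Qed.

Lemma in_set_mono m n z w :
  m <= n -> in_set (enumerated m) z w = true -> in_set (enumerated n) z w = true.
Proof.
rewrite !in_set_In; intros Hmn [H1 H2]; split; [|assumption].
now apply (enumerated_mono m).
Qed.

Lemma member_agree z u :
  eventually (fun n => agree (in_set (enumerated n) z) (member z) u).
Proof.
enough (H : eventually (fun n => forall w, In w (seq 0 u) ->
  (in_set (enumerated n) z w = true <-> member z w))).
{ revert H; apply eventually_impl; intros n H w Hw; apply H, in_seq; lia. }
apply (eventually_Forall (fun w n => in_set (enumerated n) z w = true <-> member z w)).
intros w _; destruct (classic (member z w)) as [Hw|Hw].
- destruct (Hw) as [m Hm]; exists m; intros n Hn; split; auto; intros _.
  now apply (in_set_mono m).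
- exists 0; intros n _; split; [intros H; now exists n|contradiction].
Qed.

(** The enumeration of a witness [w] cancels every witness of lower priority,
    later appointments exceed the use, and an enumeration by a node of higher
    priority would cancel [w]. *)
Lemma computation_preserved n w u :
  let s := stage_node n in
  active s -> In w (live n) -> stage_node w = s -> u <= n ->
  live (S n) = drop_lower s (live n) ->
  enumerated (S n) = w :: enumerated n ->
  (forall k, n < k -> In w (live k)) ->
  agree (in_set (enumerated n) (req_y s)) (member (req_y s)) u.
Proof.
intros s Ha Hw Es Hu HL HE Hlive z Hz; split; [intros H; now exists n|].
intros [k Hk]; apply in_set_In in Hk as [Hk Hy]; apply in_set_In; split; [|assumption].
apply NNPP; intros Hn.
(* As [s] is active, its own witness [w] cannot enter the oracle set, whereas [z] does. *)
assert (Hzw : z = w -> False).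
{ intros ->; apply Ha; now rewrite <- Es at 2. }
assert (HSn : ~ In z (enumerated (S n))).
{ rewrite HE; intros [H|H]; [apply Hzw; congruence|contradiction]. }
destruct (le_lt_dec k (S n)) as [Hkn|Hkn].
{ now apply HSn, (enumerated_mono k). }
assert (Hlast : exists m, S n <= m /\ ~ In z (enumerated m) /\ In z (enumerated (S m))).
{ clear Hy; induction k as [|k IH]; [lia|].
  destruct (classic (In z (enumerated k))) as [H|H].
  - destruct (Nat.eq_dec k (S n)) as [->|]; [contradiction|apply IH; [assumption|lia]].
  - exists k; repeat split; auto; lia. }
destruct Hlast as [m [Hm [H1 H2]]].
assert (Hact : acts m) by (right; eauto).
assert (Hzm : In z (live m)) by (apply enumerated_S_cases in H2; tauto).
assert (Hwm := Hlive m ltac:(lia)).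
assert (Ezm : stage_node z = stage_node m).
{ revert H2; destruct (stage_transition m); try contradiction.
  intros [<-|]; [assumption|contradiction]. }
assert (HzS : In z (live (S n))) by (apply (live_before (S n) m); auto; lia).
rewrite HL in HzS; apply in_drop_lower in HzS as [_ Hlow].
destruct (higher_total s (stage_node z)) as [H|[H|H]]; [congruence| |].
- apply Hzw, (live_unique m); auto; congruence.
- assert (HwS := Hlive (S m) ltac:(lia)); revert HwS.
  destruct (stage_transition m) as [| |Hv Ha' Hnone|w' u' Hv Ha' Hw' E']; try contradiction.
  rewrite in_drop_lower; intros [_ H']; congruence.
Qed.

Lemma enumeration_spec n w :
  ~ In w (enumerated n) -> In w (enumerated (S n)) ->
  exists u, In w (live n) /\ stage_node w = stage_node n /\ u <= n /\
    run (in_set (enumerated n) (req_y (stage_node n))) n (req_p (stage_node n)) w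
      = Some (0, u) /\
    live (S n) = drop_lower (stage_node n) (live n) /\
    enumerated (S n) = w :: enumerated n.
Proof.
intros H1 H2; destruct (stage_transition n) as [| | |w' u]; try contradiction.
destruct H2 as [<-|H2]; [|contradiction]; exists u; auto 10.
Qed.

(** The true node of length [⟨⟨x, y⟩, code p⟩] obtains a permanent witness [w]. If [w] is
    enumerated, the preserved computation has value 0 although [w] is a member. If not, the value
    would have to be 0, and a late visit would see this and enumerate [w]. *)
Lemma member_not_reducible (Q : relation nat) x y p :
  preorder nat Q ->
  (forall x y a, infinite_index r ⟨⟨x, y⟩, a⟩ -> Q x y) -> ~ Q x y ->
  ~ (forall w, exists v u, eval (member y) p w v u /\ char_val (member x) w v).
Proof.
intros HQ HI Hxy Hred.
destruct (true_node_exists r ⟨⟨x, y⟩, code p⟩) as [s [Hlen Hs]].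
assert (Ex : req_x s = x) by (unfold req_x; now rewrite Hlen, !pi1_pair).
assert (Ey : req_y s = y) by (unfold req_y; now rewrite Hlen, pi1_pair, pi2_pair).
assert (Ep : req_p s = code p) by (unfold req_p; now rewrite Hlen, pi2_pair).
(* The guesses of [s] are true, so [Q x z] holds for every host [z], while [Q x y] fails. *)
assert (Ha : active s).
{ intros H; apply Hxy; rewrite <- Ex, <- Ey; revert H; apply upset_sound; [assumption|].
  intros j Hj; apply trues_spec in Hj.
  assert (Hjl : j < length s).
  { destruct (Nat.lt_ge_cases j (length s)); [assumption|].
    rewrite nth_overflow in Hj; [discriminate|assumption]. }
  apply (HI _ _ (pi2 j)); unfold source, target; rewrite !pair_pi; now apply Hs. }
destruct (true_node_safe s Hs) as [m Hm].
destruct (visit_true_node r s m Hs) as [n1 [Hn1 [Hv1 E1]]].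
assert (Hw : exists w, In w (live (S n1)) /\ stage_node w = s).
{ destruct (stage_transition n1) as [Hv|Hv Hw|Hv _ Hnone|w u Hv _ Hw Es HE Hr Hu]; [congruence|..].
  - rewrite E1 in Hw; destruct (Hw Ha) as [w [Hw1 [Hw2 _]]]; exists w; split; [|assumption].
    apply in_drop_right; split; [assumption|]. rewrite Hw2, E1; apply left_of_irrefl.
  - exists n1; split; [now left|assumption].
  - exists w; split; [|congruence]; apply in_drop_lower; split; [assumption|].
    rewrite Es; apply higher_irrefl. }
destruct Hw as [w [Hw Es]].
assert (Hforever : forall k, n1 < k -> In w (live k)).
{ intros k Hk; apply (live_forever s (S n1)); auto; intros; apply Hm; lia. }
assert (Hlive : forall k, w < k -> In w (live k)).
{ intros k Hk; destruct (le_lt_dec k n1); [|auto].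
  apply (live_before k (S n1)); auto; lia. }
destruct (Hred w) as [v [u [Ev Hv]]].
destruct (classic (exists k, In w (enumerated k))) as [Hk|Hk].
- assert (Hfirst : exists n, ~ In w (enumerated n) /\ In w (enumerated (S n))).
  { destruct Hk as [k Hk]; induction k as [|k IH]; [destruct Hk|].
    destruct (classic (In w (enumerated k))); eauto. }
  destruct Hfirst as [n [H1 H2]].
  assert (Hwn : In w (live n)) by (apply enumerated_S_cases in H2; tauto).
  assert (Hwn' := live_lt _ _ Hwn).
  destruct (enumeration_spec n w H1 H2) as [u' [_ [En [Hu [Hr [HL HE]]]]]].
  rewrite Es in En; rewrite <- En, Ep, Ey in Hr.
  assert (Hagree : agree (in_set (enumerated n) y) (member y) u').
  { rewrite <- Ey, En; apply (computation_preserved n w); auto; try congruence.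
    intros k' Hk'; apply Hlive; lia. }
  apply run_sound in Hr; apply (eval_local _ (member y)) in Hr; [|exact Hagree].
  destruct (eval_det _ _ _ _ _ Hr _ _ Ev) as [<- _].
  destruct Hv as [[_ Hv]|[Hv _]]; [discriminate|]; apply Hv.
  exists (S n); apply in_set_In; split; [assumption|].
  rewrite Es, <- Ex; apply upset_self.
- assert (Hx : ~ member x w).
  { intros [k H]; apply Hk; exists k; now apply in_set_In in H. }
  destruct Hv as [[Hv _]|[_ ->]]; [contradiction|].
  destruct (run_complete _ _ _ _ _ Ev) as [n2 Hn2].
  destruct (member_agree y u) as [n3 Hn3].
  (* Late enough for [w] to be live, the run to have halted, the oracle to be correct below [u], and
     the test [u <= n] to succeed. *)
  destruct (visit_true_node r s (S n1 + n2 + n3 + u) Hs) as [n [Hn [Hvn En]]].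
  assert (Hwn : In w (live n)) by (apply Hforever; lia).
  assert (Hrun := Hn2 n _ ltac:(lia) (Hn3 n ltac:(lia))); rewrite <- Ep, <- Ey in Hrun.
  assert (Hk' : ~ In w (enumerated (S n))) by (intros H; apply Hk; eauto).
  revert Hk'; destruct (stage_transition n)
    as [Hv|Hv Hw'|Hv _ Hnone|w' u' Hv _ Hw' Es' HE Hr Hu]; intros Hk'.
  + congruence.
  + rewrite En in Hw'; destruct (Hw' Ha) as [w' [Hw1 [Hw2 Hw3]]].
    assert (w' = w) as -> by (apply (live_unique n); congruence).
    destruct Hw3 as [Hw3|Hw3]; [apply Hk; eauto|].
    apply (Hw3 u); [lia|assumption].
  + apply (Hnone w); congruence.
  + assert (w' = w) as -> by (apply (live_unique n); congruence).
    apply Hk'; now left.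
Qed.

(** * Effectiveness of the construction and indices for its sets *)

Lemma rec_hosts : recursive hosts.
Proof.
assert (Hx : recursive req_x) by (unfold req_x; rec_auto).
unfold hosts; rec_auto.
Qed.

Lemma rec_in_set {A} `{Enc A} (E : A -> list nat) (z w : A -> nat) :
  recursive E -> recursive z -> recursive w ->
  recursive (fun a => in_set (E a) (z a) (w a)).
Proof.
pose proof rec_hosts; pose proof rec_stage_node; intros; unfold in_set; rec_auto.
Qed.

Lemma rec_stage_step : recursive (fun z => stage_step (fst z) (snd z)).
Proof.
pose proof rec_hosts; pose proof rec_stage_node; pose proof (rec_visit r rec_r).
assert (Hy : recursive req_y) by (unfold req_y; rec_auto).
assert (Hp : recursive req_p) by (unfold req_p; rec_auto).
assert (Hkr : recursive (fun z => drop_right (fst z) (snd z)))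
  by (unfold drop_right; rec_auto).
assert (Hkh : recursive (fun z => drop_lower (fst z) (snd z)))
  by (unfold drop_lower; rec_auto).
unfold stage_step; rec_auto.
apply (rec_run (fun z => in_set (snd (snd (fst z))) (req_y (stage_node (fst (fst z))))));
  rec_auto.
apply rec_in_set; rec_auto.
Qed.

Lemma rec_enumerated : recursive enumerated.
Proof. pose proof rec_stage_step; unfold enumerated, state_at; rec_auto. Qed.

(** An instance of the s-m-n theorem: [z] is built into a search program by [const_prog], and the
    code of the result is computable from [z]. *)
Lemma member_index :
  exists f, computable f /\ forall z w, W (f z) w <-> member z w.
Proof.
pose proof rec_enumerated as Henum.
destruct (search_prog (fun x n => in_set (enumerated n) (pi2 x) (pi1 x)))
  as [p [Hsound Hcomplete]].
{ apply rec_in_set; rec_auto. }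
set (q z := Comp p (Pair id_prog (const_prog z))).
exists (fun z => code (q z)); split.
- apply computable_iff.
  assert (Hc : recursive (fun z => code (const_prog z))).
  (* [6 + 4 * ⟨1, c⟩] codes the composition of [Succ], whose code is 1, with the program coded by
     [c]. *)
  { apply (rec_ext (fun z => Nat.iter z (fun c => 6 + 4 * ⟨1, c⟩) 0)).
    - induction a as [|z IH]; [reflexivity|]. now rewrite Nat.iter_succ, IH.
    - apply rec_iter; [rec_auto| |rec_auto].
      apply (rec_ext (fun z => 6 + (⟨1, snd z⟩ + ⟨1, snd z⟩ + (⟨1, snd z⟩ + ⟨1, snd z⟩))));
        [intros; lia|rec_auto]. }
  unfold q; cbn [code].
  set (c := code p); set (d := code id_prog).
  assert (H4 : recursive (fun n => 4 * n)).
  { apply (rec_ext (fun n => n + n + (n + n))); [intros; lia|rec_auto]. }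
  rec_auto.
- assert (Hpair : forall O z w, eval O (Pair id_prog (const_prog z)) w ⟨w, z⟩ 0).
  { intros O z w; apply (eval_pair O id_prog (const_prog z) w _ _ 0 0);
      [apply eval_id|apply eval_const]. }
  intros z w; split.
  + intros [q' [y [u [Ec E]]]]; apply code_inj in Ec; subst q'.
    apply eval_inv in E as [v [u1 [u2 [E1 [E2 _]]]]].
    destruct (eval_det _ _ _ _ _ E1 _ _ (Hpair _ _ _)) as [-> _].
    apply Hsound in E2; rewrite pi1_pair, pi2_pair in E2; now exists y.
  + intros [n Hn].
    destruct (Hcomplete ⟨w, z⟩ n) as [m [_ Hm]]; [now rewrite pi1_pair, pi2_pair|].
    exists (q z), m, 0; split; [reflexivity|].
    apply (eval_comp _ p _ w ⟨w, z⟩ m 0 0); auto.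
Qed.

(** Membership of [w] in the [x]-th set is decided outright, except for the
    witnesses of the nodes that extend [s], which enter the [x]-th set only
    together with the [y]-th one. A witness of a node to the right of [s] is
    settled as soon as [s] is visited again. *)
Lemma member_reducible x y a :
  infinite_index r ⟨⟨x, y⟩, a⟩ -> wtt_le (member x) (member y).
Proof.
intros Hj; set (j := ⟨⟨x, y⟩, a⟩) in *.
(* Length [S j] makes [j] the last index guessed by [s]. *)
destruct (true_node_exists r (S j)) as [s [Hlen Hs]].
assert (Hsj : nth j s false = true) by (apply Hs; [lia|assumption]).
destruct (true_node_safe s Hs) as [m Hm].
(* Below [m], where [s] may still be injured, a finite table is used. *)
assert (Hfin : exists l, forall w, w < m -> (In w l <-> member x w)).
{ clear Hm; induction m as [|m [l Hl]]; [exists []; lia|].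
  destruct (classic (member x m)) as [Hx|Hx];
    [exists (m :: l)|exists (remove Nat.eq_dec m l)]; intros w Hw.
  - cbn; destruct (Nat.eq_dec w m) as [->|Hne]; [tauto|].
    rewrite <- Hl by lia; intuition congruence.
  - destruct (Nat.eq_dec w m) as [->|Hne].
    + split; [intros H; now apply remove_In in H|contradiction].
    + rewrite <- Hl by lia; split; [apply in_remove|].
      intros H; now apply in_in_remove. }
destruct Hfin as [l Hl].
pose proof rec_enumerated as Henum; pose proof rec_stage_node as Hnode.
pose proof rec_hosts as Hhosts; pose proof (rec_visit r rec_r) as Hvisit.
(* [g w] is a stage after [w] at which [s] is visited. *)
destruct (rec_search (fun w n =>
  (w <? n) && (visit r n && node_eqb (stage_node n) s))) as [g [Hg Hgs]].
{ rec_auto. }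
{ intros w; destruct (visit_true_node r s (S w) Hs) as [n [Hn [Hv E]]].
  exists n; rewrite Hv, E, (proj2 (node_eqb_eq s s) eq_refl).
  now rewrite (proj2 (Nat.ltb_lt w n) Hn). }
(* The value 2 means that the answer of the oracle at [w] is to be copied. *)
set (d w :=
  if w <? m then if memb w l then 1 else 0
  else if prefixb s (stage_node w)
  then if memb x (hosts (stage_node w)) then 2 else 0
  else if in_set (enumerated (S (g w))) x w then 1 else 0).
assert (Hd : recursive d).
{ unfold d; rec_auto; apply rec_in_set; rec_auto. }
assert (Hdec : forall w, char_val (member x) w (d w) \/
  d w = 2 /\ (member x w <-> member y w)).
{ intros w; unfold d.
  destruct (Nat.ltb_spec w m) as [Hwm|Hwm].
  { left; unfold char_val; rewrite <- (Hl w Hwm), <- memb_In.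
    destruct (memb w l); auto. }
  destruct (prefixb s (stage_node w)) eqn:Hp.
  - destruct (memb x (hosts (stage_node w))) eqn:Hx.
    + right; split; [reflexivity|]; apply memb_In in Hx.
      assert (Hy : In y (hosts (stage_node w))).
      { replace y with (target j) by (unfold target, j; now rewrite pi1_pair, pi2_pair).
        apply upset_closed.
        - apply trues_spec; rewrite (prefixb_nth s); auto; lia.
        - unfold source, j; now rewrite !pi1_pair. }
      split; intros [n Hn]; exists n; apply in_set_In; apply in_set_In in Hn; tauto.
    + left; right; split; [|reflexivity]; intros [n Hn].
      apply in_set_In in Hn as [_ Hn]; apply memb_In in Hn; congruence.
  - left; specialize (Hgs w); rewrite !andb_true_iff, Nat.ltb_lt, node_eqb_eq in Hgs.
    destruct Hgs as [Hgw [Hv Eg]].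
    destruct (in_set (enumerated (S (g w))) x w) eqn:Hin; [left|right];
      (split; [|reflexivity]).
    { now exists (S (g w)). }
    intros [n Hn]; apply in_set_In in Hn as [Hn Hx].
    assert (Happ := enumerated_appointed _ _ Hn).
    (* Stage [w] acts and is safe for [s], so the node of [w] does not have higher priority; not
       extending [s], it lies to the right. *)
    destruct (Hm w Hwm) as [_ Hhigh]; specialize (Hhigh (or_introl Happ)).
    apply not_higher_cases in Hhigh as [Hhigh|Hleft]; [congruence|].
    (* Every kind of visit of [s] cancels the witnesses to its right, so [w] can only have been
       enumerated by then. *)
    assert (Hdead : ~ In w (live (S (g w)))).
    { assert (Hne : w <> g w) by lia.
      destruct (stage_transition (g w)) as [| | |]; [congruence|..]; cbn [In];
        rewrite ?in_drop_right, ?in_drop_lower, Eg;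
        [|rewrite (left_of_higher _ _ Hleft)..]; intuition congruence. }
    assert (Hin' : In w (enumerated (S (g w)))).
    { destruct (le_lt_dec n (S (g w))); [now apply (enumerated_mono n)|].
      destruct (enumerated_before (S (g w)) n w); auto; [lia..|contradiction]. }
    assert (in_set (enumerated (S (g w))) x w = true) by (now apply in_set_In).
    congruence. }
assert (Hsel : recursive (fun z => if d (pi1 z) =? 2 then pi2 z else d (pi1 z))) by rec_auto.
destruct Hsel as [sel [[p Hp] Esel]].
(* The query is made for every [w], so the use is always [S w]. *)
exists (Comp p (Pair id_prog Query)), S; split; [apply computable_iff; rec_auto|].
intros w.
assert (Hq : exists b, eval (member y) Query w b (S w) /\ char_val (member y) w b).
{ destruct (classic (member y w)); [exists 1|exists 0];
    (split; [now constructor|unfold char_val; auto]). }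
destruct Hq as [b [Hq Hb]].
exists (if d w =? 2 then b else d w), (S w); repeat split; [| |lia].
- specialize (Hp (member y) ⟨w, b⟩).
  rewrite (Esel ⟨w, b⟩ : sel ⟨w, b⟩ = _), pi1_pair, pi2_pair in Hp.
  rewrite <- (Nat.max_0_r (S w)).
  apply (eval_comp _ p _ w ⟨w, b⟩); [|assumption].
  apply (eval_pair _ id_prog Query w w b 0 (S w)); [apply eval_id|assumption].
- destruct (Hdec w) as [Hc|[-> Hiff]].
  + destruct (Nat.eqb_spec (d w) 2) as [E|_]; [|assumption].
    rewrite E in Hc; destruct Hc as [[_ Hc]|[_ Hc]]; discriminate.
  + cbn [Nat.eqb]; unfold char_val in *; tauto.
Qed.

End Construction.

(** * Completeness *)

Theorem theorem4p17 :
  sigma3_complete_preorder (fun e i => wtt_le (W e) (W i)).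
Proof.
split; [split; [split|]|].
- intros e; apply wtt_le_refl.
- intros e i k; apply wtt_le_trans.
- apply sigma3_wtt_le.
- intros Q [HQ [R [[g [Hg HR]] HQR]]].
  apply computable_iff in Hg.
  (* In [j = ⟨⟨x, y⟩, a⟩], the first component is the argument of the Sigma_3 predicate and the
     second its outermost witness, so [j] is infinite exactly when [a] witnesses [Q x y]. *)
  set (r := fun j b c => g ⟨pi1 j, ⟨pi2 j, ⟨b, c⟩⟩⟩ =? 1).
  assert (rec_r : recursive (fun z => r (fst (fst z)) (snd (fst z)) (snd z))).
  { unfold r; rec_auto. }
  assert (HI : forall x y a, infinite_index r ⟨⟨x, y⟩, a⟩ <->
    forall b, exists c, R ⟨⟨x, y⟩, ⟨a, ⟨b, c⟩⟩⟩).
  { intros x y a; unfold infinite_index, r; rewrite pi1_pair, pi2_pair.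
    split; intros H b; destruct (H b) as [c Hc]; exists c;
      [apply Nat.eqb_eq in Hc|apply Nat.eqb_eq];
      destruct (HR ⟨⟨x, y⟩, ⟨a, ⟨b, c⟩⟩⟩) as [[? ?]|[? ?]]; congruence || contradiction. }
  assert (HQI : forall x y, Q x y <-> exists a, infinite_index r ⟨⟨x, y⟩, a⟩).
  { intros x y; transitivity (pair_set Q ⟨x, y⟩).
    - split; [intros H; now exists x, y|].
      intros [x' [y' [E H]]]; apply pair_inj in E as [-> ->]; assumption.
    - rewrite HQR; split; intros [a Ha]; exists a; now apply HI. }
  destruct (member_index r rec_r) as [f [Hf HW]]; exists f; split; [assumption|].
  assert (HW' : forall z w, member r z w <-> W (f z) w) by (intros; symmetry; apply HW).
  intros x y; rewrite HQI; split.
  + intros [a Ha]; apply (wtt_le_ext (member r x) (member r y)); auto.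
    now apply (member_reducible r rec_r x y a).
  + intros H; apply (wtt_le_ext _ _ (member r x) (member r y)) in H; auto.
    apply HQI, NNPP; intros Hxy.
    destruct H as [p [h [_ Hp]]].
    apply (member_not_reducible r Q x y p HQ); [|assumption|].
    * intros x' y' a Ha; apply HQI; eauto.
    * intros w; destruct (Hp w) as [v [u [Ev [Hv _]]]]; eauto.
Qed.
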